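(* Let $H_1,H_2\in\mathbb{C}^{N\times N}$ be Hermitian, $T>0$, $\boldsymbol{u}_I\in\mathbb{C}^N$, and let $\boldsymbol{u}_f(t)=\mathrm{e}^{(H_1+\mathrm{i}H_2)t}\boldsymbol{u}_I$ be the solution of $\frac{\mathrm{d}}{\mathrm{d}t}\boldsymbol{u}_f=(H_1+\mathrm{i}H_2)\boldsymbol{u}_f$, $\boldsymbol{u}_f(0)=\boldsymbol{u}_I$. Let $R>(\lambda^-_{\max}(H_1)+\lambda^+_{\max}(H_1))T$ and let $\psi\in L^2(\mathbb{R})$ satisfy $\psi(p)=\mathrm{e}^{-p}$ for (almost) all $p\in(0,R)$. Let $\boldsymbol{w}\in C([0,T];L^2(\mathbb{R};\mathbb{C}^N))$ be the solution of \[ \partial_t\boldsymbol{w}=-H_1\,\partial_p\boldsymbol{w}+\mathrm{i}H_2\,\boldsymbol{w},\qquad \boldsymbol{w}(0,p)=\psi(p)\,\boldsymbol{u}_I \] (given by the unitary group generated by $-H_1\partial_p+\mathrm{i}H_2$ on $L^2(\mathbb{R};\mathbb{C}^N)$). Then \[ \boldsymbol{u}_f(T)=\mathrm{e}^{p}\,\boldsymbol{w}(T,p)\qquad\text{for (almost) all } p\in\big(\lambda^+_{\max}(H_1)T,\;R-\lambda^-_{\max}(H_1)T\big). \]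
   Context: For a Hermitian matrix $H_1$: $\lambda^+_{\max}(H_1)$ is the largest positive eigenvalue of $H_1$ if one exists and $0$ otherwise; $\lambda^-_{\max}(H_1)$ is the largest absolute value of a negative eigenvalue of $H_1$ if one exists and $0$ otherwise. *)

(* Defs.v *)
From HB Require Import structures.
From mathcomp Require Import all_boot all_order all_algebra.
From mathcomp Require Import complex.
From mathcomp Require Import all_classical all_reals all_analysis.

Set Implicit Arguments.
Unset Strict Implicit.
Unset Printing Implicit Defensive.

Import Order.TTheory GRing.Theory Num.Theory.
Import numFieldNormedType.Exports.
Local Open Scope classical_set_scope.
Local Open Scope ring_scope.

Section Defs.
Context {R : realType}.
Local Notation C := (R[i]).

Definition is_hermitian {N : nat} (H : 'M[C]_N) : Prop :=
  forall i j, H i j = conjc (H j i).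

Definition lam_pos_max {N : nat} (H : 'M[C]_N) : R :=
  sup ([set 0] `|` [set x : R | 0 < x /\ eigenvalue H (x%:C)%C]).

Definition lam_neg_max {N : nat} (H : 'M[C]_N) : R :=
  sup ([set 0] `|` [set x : R | 0 < x /\ eigenvalue H ((- x)%:C)%C]).

Definition cnorm2 (z : C) : R := complex.Re z ^+ 2 + complex.Im z ^+ 2.

Definition vnorm2 {N : nat} (v : 'cV[C]_N) : R := \sum_(j < N) cnorm2 (v j 0).

Definition L2fun (f : R -> C) : Prop :=
  measurable_fun setT (fun p => complex.Re (f p)) /\
  measurable_fun setT (fun p => complex.Im (f p)) /\
  (\int[lebesgue_measure]_p (cnorm2 (f p))%:E < +oo)%E.

Definition L2vec {N : nat} (f : R -> 'cV[C]_N) : Prop :=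
  (forall j : 'I_N, measurable_fun setT (fun p => complex.Re (f p j 0)) /\
                    measurable_fun setT (fun p => complex.Im (f p j 0))) /\
  (\int[lebesgue_measure]_p (vnorm2 (f p))%:E < +oo)%E.

Definition L2dist2 {N : nat} (f g : R -> 'cV[C]_N) : R :=
  (\int[lebesgue_measure]_p vnorm2 (f p - g p))%R.

Definition cintegral (h : R -> C) : C :=
  ((\int[lebesgue_measure]_p complex.Re (h p))%R +i* (\int[lebesgue_measure]_p complex.Im (h p))%R)%C.

Definition pairing {N : nat} (f g : R -> 'cV[C]_N) : C :=
  cintegral (fun p => \sum_(j < N) f p j 0 * g p j 0).

Definition C1c (a : R -> R) : Prop :=
  (forall x, derivable a x 1) /\ continuous (derive1 a) /\
  exists M : R, forall x, M < `|x| -> a x = 0.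

Definition ode_solution {N : nat} (A : 'M[C]_N) (u0 : 'cV[C]_N)
    (u : R -> 'cV[C]_N) : Prop :=
  u 0 = u0 /\
  forall (t : R) (j : 'I_N),
    is_derive t (1 : R) (fun s => complex.Re (u s j 0)) (complex.Re ((A *m u t) j 0)) /\
    is_derive t (1 : R) (fun s => complex.Im (u s j 0)) (complex.Im ((A *m u t) j 0)).

(* w in C([0,T]; L^2(R;C^N)) is the solution of
     d_t w = - H1 d_p w + i H2 w,  w(0) = w0,
   i.e. w(t) = exp(t(-H1 d_p + i H2)) w0 given by the unitary group.
   It is characterized (Ball's theorem) as the weak solution:
   for every test function chi (C^1 with compact support),
   t |-> <w(t), chi> is differentiable on (0,T) with derivative
   <w(t), H1^T chi' + i H2^T chi>  (bilinear pairing). *)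
Definition group_solution {N : nat} (H1 H2 : 'M[C]_N) (T : R)
    (w0 : R -> 'cV[C]_N) (w : R -> R -> 'cV[C]_N) : Prop :=
  (forall t, 0 <= t <= T -> L2vec (w t)) /\
  (forall t0, 0 <= t0 <= T -> forall e : R, 0 < e ->
     exists2 d : R, 0 < d & forall t, 0 <= t <= T -> `|t - t0| < d ->
       L2dist2 (w t) (w t0) < e) /\
  {ae lebesgue_measure, forall p, w 0 p = w0 p} /\
  (forall a b : 'I_N -> R -> R,
     (forall j, C1c (a j)) -> (forall j, C1c (b j)) ->
     let chi := fun p => \col_j ((a j p) +i* (b j p))%C in
     let dchi := fun p => \col_j ((derive1 (a j) p) +i* (derive1 (b j) p))%C in
     let Achi := fun p => H1^T *m dchi p + 'i%C *: (H2^T *m chi p) in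
     forall t, 0 < t < T ->
       is_derive t (1 : R) (fun s => complex.Re (pairing (w s) chi))
                 (complex.Re (pairing (w t) Achi)) /\
       is_derive t (1 : R) (fun s => complex.Im (pairing (w s) chi))
                 (complex.Im (pairing (w t) Achi))).

End Defs.

(* Main.v *)
Require Import Defs.
From HB Require Import structures.
From mathcomp Require Import all_boot all_order all_algebra.
From mathcomp Require Import complex.
From mathcomp Require Import all_classical all_reals all_analysis.
From mathcomp Require Import measurable_realfun.
From mathcomp Require Import ring lra.

(* The defect z(t, p) = w(t, p) - e^{-p} uf(t) is a weak solution of
   z_t = - H1 z_p + i H2 z which vanishes at t = 0 on (0, R), so the claim is
   finite speed of propagation. Let the rows of P be left eigenvectors of H1,
   with eigenvalues lam_k. If a is a test function supported in
   (lp t, R - lm t), where lp and lm bound the propagation speeds, then its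
   translate a_s = a(. - lam_k (s - t)) along the k-th characteristic is
   supported in (lp s, R - lm s) for s <= t, and the transport term cancels in
   d/ds <(P z)_k(s), a_s> = sum_l B_kl <(P z)_l(s), a_s>.
   Translation preserves the sup norm, so a bound K e^{2Ct} on all these
   pairings with |a| <= 1 integrates to the bound (K/2) e^{2Ct}; hence all of
   them vanish. *)

(** The solution [w] is continuous in time only with values in L^2 and solves the equation only
    against test functions, so characteristics cannot be followed pointwise; the test function
    follows them instead. In the eigenbasis of [H1] the matrix of [i H2] is in general not diagonal:
    a test function travelling with the speed of one coordinate gets paired with coordinates of
    other speeds. This is why a bound must be carried for all coordinates and all tests in the cone
    at once. The initial [K] is an L^1 bound on (0, R), uniform in time by compactness of [0, T].
    Restricting to the bounded interval (0, R) turns L^2 control into L^1 control and accommodates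
    e^{-p}, which is not square integrable on the line. That e^{-p} uf solves the same equation is
    the identity - d/dp e^{-p} = e^{-p}. Real and imaginary parts are separated, so that the system
    has 2N real unknowns. *)

Import Order.TTheory GRing.Theory Num.Theory.
Import numFieldNormedType.Exports.
Local Open Scope classical_set_scope.
Local Open Scope ring_scope.

(** * Calculus on the real line *)

Section Calculus.
Set Implicit Arguments.
Unset Strict Implicit.
Variable R : realType.
Implicit Types (f : R -> R) (x l : R).

Lemma is_derive_cvg f x l :
  h^-1 *: (f (h + x) - f x) @[h --> 0^'] --> l -> is_derive x 1 f l.
Proof.
move=> fl.
have fl' : h^-1 *: ((f \o shift x) (h *: 1) - f x) @[h --> 0^'] --> l.
  suff -> : (fun h => h^-1 *: ((f \o shift x) (h *: 1) - f x)) =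
            (fun h => h^-1 *: (f (h + x) - f x)) by [].
  by apply/funext => h /=; rewrite /shift /= [h *: 1]mulr1.
split; first by apply/cvg_ex; exists l.
exact/cvg_lim.
Qed.

Lemma is_derive_littleo f x l :
  (forall e, 0 < e -> exists2 d, 0 < d & forall s, `|s - x| < d ->
     `|f s - f x - l * (s - x)| <= e * `|s - x|) ->
  is_derive x 1 f l.
Proof.
move=> H; apply: is_derive_cvg; apply/cvgrPdist_le => e e0.
have [d d0 Hd] := H _ e0.
near=> h.
have h0 : h != 0 by near: h; exact: nbhs_dnbhs_neq.
have hd : `|h| < d by near: h; exact: dnbhs0_lt.
have := Hd (h + x); rewrite addrK => /(_ hd).
set X := f (h + x) - f x => HX.
have -> : l - h^-1 *: X = h^-1 * (l * h - X) by rewrite /GRing.scale /=; field.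
by rewrite normrM normfV ler_pdivrMl ?normr_gt0// distrC [_ * e]mulrC.
Unshelve. all: by end_near. Qed.

(* The exponent carries twice the constant [C] of the bound on [df], so that
   integration gains a factor 2. *)
Lemma exp_derive_bound f (df : R -> R) (t C K : R) : 0 <= t -> 0 < C -> 0 <= K ->
  f 0 = 0 -> {within `[0, t], continuous f} ->
  (forall s, 0 < s < t -> is_derive s (1 : R) f (df s)) ->
  (forall s, 0 < s < t -> `|df s| <= C * (K * expR (2 * C * s))) ->
  `|f t| <= K / 2 * expR (2 * C * t).
Proof.
move=> t0 C0 K0 f0 cf Df ub.
pose g s := K / 2 * expR (2 * C * s).
have Dg s : is_derive s (1 : R) g (C * (K * expR (2 * C * s))).
  apply: is_derive_eq => /=.
  by rewrite /GRing.scale /=; field.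
have cg : {within `[0, t], continuous g}.
  by apply: derivable_within_continuous => s _; exact: ex_derive.
(* The cases [e = 1] and [e = -1] together bound [|f t|]. For each [e], [g - e f] is nondecreasing,
   because [g'] is the bound assumed on [|df|], and it starts at [g 0 >= 0]. *)
suff H (e : R) : `|e| <= 1 -> e * f t <= g t.
  have := H 1; have := H (-1); rewrite normrN normr1 lexx mulN1r mul1r.
  by move=> /(_ isT) H1 /(_ isT) H2; rewrite ler_norml H2 andbT lerNl.
move=> e1.
pose h : R -> R := g - (fun s => e * f s).
have hE x : h x = g x - e * f x by [].
have g0 : 0 <= g 0 by rewrite mulr_ge0 ?expR_ge0 ?divr_ge0.
have Dh s : s \in `]0, t[%R -> is_derive s (1 : R) h (C * (K * expR (2 * C * s)) - e * df s).
  rewrite in_itv => st.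
  apply: is_deriveB => //.
  have := Df s st => Dfs.
  exact: is_deriveZ.
have ch : {within `[0, t], continuous h}.
  move=> x; apply: cvgB; first exact: cg.
  by apply: cvgMr; exact: cf.
have h0 : h 0 = g 0 by rewrite hE f0 mulr0 subr0.
have hd s : s \in `]0, t[%R -> derivable h s 1 by move=> /Dh[].
have hd0 s : s \in `]0, t[%R -> 0 <= derive1 h s.
  move=> st; rewrite derive1E; have [_ ->] := Dh s st; rewrite subr_ge0.
  move: st; rewrite in_itv /= => st.
  rewrite (le_trans (ler_norm _))// normrM (le_trans _ (ub s st))//.
  by rewrite ler_piMl.
have t0in : 0 \in `[0, t]%R by rewrite in_itv /= lexx.
have ttin : t \in `[0, t]%R by rewrite in_itv /= lexx t0.
have := @ger0_derive1_le_cc _ h 0 t hd hd0 ch 0 t t0in ttin t0.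
rewrite h0.
by rewrite hE lerBrDr; apply: le_trans; rewrite lerDr.
Qed.

Lemma continuous_within_itvcc f (u v : R) :
  (forall s0, u <= s0 <= v -> forall e, 0 < e -> exists2 d, 0 < d &
    forall s, u <= s <= v -> `|s - s0| < d -> `|f s - f s0| < e) ->
  {within `[u, v], continuous f}.
Proof.
move=> H; apply/subspace_continuousP => x /=; rewrite in_itv /= => xuv.
apply/cvgrPdist_lt => e e0; have [d d0 Hd] := H x xuv e e0.
rewrite /nbhs /= /within /=; exists d => //= s xs; rewrite in_itv /= => suv.
by rewrite distrC; apply: Hd => //; rewrite distrC.
Qed.

End Calculus.

(** * Compactly supported C^1 test functions *)

Section TestFunctions.
Set Implicit Arguments.
Unset Strict Implicit.
Variable R : realType.
Implicit Types (f a b : R -> R) (x l : R).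

Lemma compact_support_bounded f M : continuous f ->
  (forall x, M < `|x| -> f x = 0) ->
  exists2 L : R, 0 <= L & forall x, `|f x| <= L.
Proof.
move=> cf f0; pose N : R := Num.max M 0.
have N0 : 0 <= N by rewrite le_max lexx orbT.
have cn : {within `[- N, N], continuous (fun x => `|f x|)}.
  by apply: continuous_subspaceT => x; apply: cvg_norm; exact: cf.
have NN : - N <= N by rewrite ge0_cp.
have [c _ Hc] := EVT_max NN cn.
exists (`|f c|) => // x.
have [xN|xN] := leP (`|x|) N.
  by apply: Hc; rewrite in_itv /= -ler_norml.
by rewrite f0 ?normr0// (le_lt_trans _ xN)// le_max lexx.
Qed.

Lemma C1c_continuous a : C1c a -> continuous a.
Proof. by move=> [da _] x; apply: differentiable_continuous; exact/derivable1_diffP. Qed.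

Lemma C1c_is_derive a x : C1c a -> is_derive x (1 : R) a (derive1 a x).
Proof. by move=> [da _]; rewrite derive1E; exact/derivableP. Qed.

Lemma derive1_eq0_near a x : (\forall y \near x, a y = 0) -> derive1 a x = 0.
Proof.
move=> a0; rewrite derive1E.
have : is_derive x (1 : R) a 0.
  by apply: (@near_eq_is_derive _ _ _ (cst 0)) => //; near=> y; apply/esym; near: y.
by case.
Unshelve. all: by end_near. Qed.

Lemma C1c_derive1_support a M : (forall x, M < `|x| -> a x = 0) ->
  forall x, M < `|x| -> derive1 a x = 0.
Proof.
move=> a0 x Mx; apply: derive1_eq0_near.
apply: filterS a0 _.
have : `|y| @[y --> x] --> `|x| by apply: cvg_norm; exact: cvg_id.
by move=> /cvgr_gt; apply.
Qed.

Lemma C1c_bounded a : C1c a -> exists2 L : R, 0 <= L & forall x, `|a x| <= L.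
Proof.
by move=> Ca; case: (Ca) => _ [_ [M HM]]; exact: compact_support_bounded (C1c_continuous Ca) HM.
Qed.

Lemma C1c_derive1_bounded a : C1c a ->
  exists2 L : R, 0 <= L & forall x, `|derive1 a x| <= L.
Proof.
move=> [_ [ca [M HM]]].
exact: compact_support_bounded ca (C1c_derive1_support HM).
Qed.

Lemma C1c_lipschitz a L : C1c a -> (forall x, `|derive1 a x| <= L) ->
  forall x y, `|a x - a y| <= L * `|x - y|.
Proof.
move=> Ca HL.
have H x y : x <= y -> `|a y - a x| <= L * `|y - x|.
  move=> xy; have [|c _ ->] := MVT_segment xy (fun z _ => C1c_is_derive z Ca).
    by apply: continuous_subspaceT; exact: C1c_continuous.
  by rewrite normrM ler_wpM2r.
move=> x y; have [|/ltW] := leP x y; last exact: H.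
by move=> /H; rewrite distrC [`|y - x|]distrC.
Qed.

Lemma is_derive_shift a c x l : is_derive (x + c) (1 : R) a l ->
  is_derive x (1 : R) (fun y => a (y + c)) l.
Proof.
move=> Da; have Dc : is_derive x (1 : R) (fun y => y + c) (1 + 0).
  exact: is_deriveD.
by have := @is_derive1_comp R a (fun y => y + c) x _ _ Da Dc; rewrite addr0 mulr1.
Qed.

Lemma derive1_shift a c : C1c a ->
  derive1 (fun y => a (y + c)) = (fun x => derive1 a (x + c)).
Proof.
move=> Ca; apply/funext => x; rewrite [LHS]derive1E.
by have [_ ->] := is_derive_shift (C1c_is_derive (x + c) Ca).
Qed.

Lemma C1c_shift a c : C1c a -> C1c (fun y => a (y + c)).
Proof.
move=> Ca; split.
  by move=> x; have [] := is_derive_shift (C1c_is_derive (x + c) Ca).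
split; last first.
  case: Ca => _ [_ [M HM]]; exists (M + `|c|) => x Hx; apply: HM.
  by rewrite -(ltrD2r `|c|) (lt_le_trans Hx)// -{1}[x](addrK c) ler_normB.
rewrite derive1_shift// => x.
apply: continuous_comp; last by case: Ca => _ [+ _]; exact.
by apply: continuousD; [exact: cvg_id|exact: cvg_cst].
Qed.

Lemma derive1_scale (r : R) a : C1c a ->
  derive1 (fun y => r * a y) = (fun x => r * derive1 a x).
Proof.
move=> Ca; apply/funext => x; rewrite [LHS]derive1E.
by have [_ ->] := is_deriveZ r (C1c_is_derive x Ca).
Qed.

Lemma C1c_scale (r : R) a : C1c a -> C1c (fun y => r * a y).
Proof.
move=> Ca; split.
  by move=> x; have [] := is_deriveZ r (C1c_is_derive x Ca).
split; last first.
  by case: Ca => _ [_ [M HM]]; exists M => x /HM ->; rewrite mulr0.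
rewrite derive1_scale// => x.
by apply: cvgMr; case: Ca => _ [+ _]; exact.
Qed.

End TestFunctions.

(** * Smooth bumps on an interval *)

Section Bump.
Set Implicit Arguments.
Unset Strict Implicit.
Variable R : realType.
Implicit Types (x c d : R) (n : nat).

Let pos2 x : R := (Num.max x 0) ^+ 2.

Let is_derive_pos2 x : is_derive x (1 : R) pos2 (2 * Num.max x 0).
Proof.
apply: is_derive_littleo => e e0; exists e => // s sx.
(* The first-order remainder of the squared positive part is at most [(s - x) ^+ 2] in all four sign
   cases, so [e] itself serves as radius. *)
apply: (@le_trans _ _ (`|s - x| * `|s - x|)); last by rewrite ler_wpM2r// ltW.
rewrite -normrM -expr2 (ger0_norm (sqr_ge0 _)) ler_norml /pos2.
by case: (leP x 0) => x0; case: (leP s 0) => s0; apply/andP; split; have := sqr_ge0 (s - x); nra.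
Qed.

Let continuous_max0 : continuous (fun x : R => Num.max x 0).
Proof. by move=> x; apply: continuous_max; [exact: cvg_id|exact: cvg_cst]. Qed.

(* C^1, with values in [0, 1); as n grows, [ramp (n x)] tends to the indicator of [x > 0]. *)
Definition ramp x : R := 1 - (1 + (Num.max x 0) ^+ 2)^-1.

Let den_gt0 x : 0 < 1 + (Num.max x 0) ^+ 2.
Proof. by rewrite ltr_wpDr ?sqr_ge0. Qed.

Let ramp' x : R := 2 * Num.max x 0 * (1 + (Num.max x 0) ^+ 2) ^- 2.

Lemma is_derive_ramp x : is_derive x (1 : R) ramp (ramp' x).
Proof.
have D1 : is_derive x (1 : R) (fun y => 1 + (Num.max y 0) ^+ 2) (0 + 2 * Num.max x 0).
  by apply: is_deriveD; exact: is_derive_pos2.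
have D2 := @is_deriveV R _ x _ 1 (lt0r_neq0 (den_gt0 x)) D1.
have D3 : is_derive x (1 : R) ramp _ := is_deriveB (is_derive_cst (1 : R) x (1 : R)) D2.
apply: (is_derive_eq D3).
by rewrite sub0r scaleNr opprK add0r [LHS]mulrC.
Qed.

Lemma continuous_ramp' : continuous ramp'.
Proof.
move=> x; rewrite /ramp'; apply: cvgM.
  by apply: cvgMr; exact: continuous_max0.
apply: cvgV; first by rewrite expf_neq0// lt0r_neq0.
suff den : 1 + Num.max y 0 ^+ 2 @[y --> x] --> 1 + Num.max x 0 ^+ 2.
  exact: (cvgM den den).
have mx : Num.max y (0 : R) @[y --> x] --> Num.max x (0 : R) := @continuous_max0 x.
have mx2 : Num.max y (0 : R) * Num.max y (0 : R) @[y --> x] --> Num.max x (0 : R) * Num.max x (0 : R).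
  exact: cvgM.
by apply: cvgD; [exact: cvg_cst|exact: mx2].
Qed.

Lemma ramp_ge0 x : 0 <= ramp x.
Proof. by rewrite subr_ge0 invf_le1// lerDl sqr_ge0. Qed.

Lemma ramp_le1 x : ramp x <= 1.
Proof. by rewrite gerBl invr_ge0 ltW. Qed.

Lemma ramp_le0 x : x <= 0 -> ramp x = 0.
Proof. by move=> x0; rewrite /ramp max_r// expr0n addr0 invr1 subrr. Qed.

Lemma ramp_cvg x : 0 < x -> ramp (n%:R * x) @[n --> \oo] --> (1 : R).
Proof.
move=> x0; apply/cvgrPdist_le => e e0.
near=> n.
have n1 : 1 <= n%:R :> R by rewrite ler1n; near: n; exact: nbhs_infty_gt.
(* The distance from [ramp (n x)] to 1 is [1 / (1 + (n x)^2)]; with [n <= n^2], this choice of [n]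
   gives [(n x)^2 >= 1 / e]. *)
have ne : e^-1 * x ^- 2 <= n%:R by near: n; exact: nbhs_infty_ger.
rewrite /ramp opprB addrC subrK max_l ?mulr_ge0//; last exact: ltW.
rewrite ger0_norm; last by rewrite invr_ge0 addr_ge0// sqr_ge0.
rewrite -[leRHS]invrK lef_pV2 ?posrE ?invr_gt0//; last by rewrite ltr_wpDr ?sqr_ge0.
move: ne; rewrite ler_pdivrMr ?exprn_gt0// => ne.
rewrite (le_trans ne)// exprMn.
rewrite (@le_trans _ _ (n%:R ^+ 2 * x ^+ 2))// ?lerDr//.
by rewrite ler_wpM2r ?sqr_ge0// expr2 ler_peMl.
Unshelve. all: by end_near. Qed.

(** Approximates the indicator of []c, d[] from below and inside: the support does not grow with
    [n], so all bumps of one interval are admissible in the same slice of the cone. *)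
Definition bump c d n x : R := ramp (n%:R * (x - c)) * ramp (n%:R * (d - x)).

Lemma bump_ge0 c d n x : 0 <= bump c d n x.
Proof. by rewrite mulr_ge0 ?ramp_ge0. Qed.

Lemma bump_le1 c d n x : bump c d n x <= 1.
Proof. by rewrite mulr_ile1 ?ramp_ge0 ?ramp_le1. Qed.

Lemma bump_eq0 c d n x : ~~ (c < x < d) -> bump c d n x = 0.
Proof.
rewrite negb_and -!leNgt => /orP[xc|dx]; rewrite /bump.
  by rewrite ramp_le0 ?mul0r// mulr_ge0_le0// subr_le0.
by rewrite [X in _ * X]ramp_le0 ?mulr0// mulr_ge0_le0// subr_le0.
Qed.

Lemma bump_cvg c d x : c < x < d -> bump c d n x @[n --> \oo] --> (1 : R).
Proof.
move=> /andP[cx xd]; rewrite -[1]mulr1.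
by apply: cvgM; apply: ramp_cvg; rewrite subr_gt0.
Qed.

Lemma C1c_bump c d n : C1c (bump c d n).
Proof.
pose l x : R := n%:R * (x - c); pose r x : R := n%:R * (d - x).
have Dl x : is_derive x (1 : R) l n%:R.
  have : is_derive x (1 : R) (fun x => x - c) (1 - 0) by exact: is_deriveB.
  move=> /(is_deriveZ n%:R) D; apply: (is_derive_eq D).
  by rewrite /GRing.scale /= subr0 mulr1.
have Dr x : is_derive x (1 : R) r (- n%:R).
  have : is_derive x (1 : R) (fun x => d - x) (0 - 1) by exact: is_deriveB.
  move=> /(is_deriveZ n%:R) D; apply: (is_derive_eq D).
  by rewrite /GRing.scale /= sub0r mulrN1.
have D x : is_derive x (1 : R) (bump c d n)
    (ramp (l x) * (ramp' (r x) * - n%:R) + ramp (r x) * (ramp' (l x) * n%:R)).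
  have D1 := @is_derive1_comp R ramp l x _ _ (is_derive_ramp _) (Dl x).
  have D2 := @is_derive1_comp R ramp r x _ _ (is_derive_ramp _) (Dr x).
  exact: is_deriveM D1 D2.
have cl : continuous l.
  by move=> x; apply: cvgMr; apply: cvgB; [exact: cvg_id|exact: cvg_cst].
have cr : continuous r.
  by move=> x; apply: cvgMr; apply: cvgB; [exact: cvg_cst|exact: cvg_id].
have cramp : continuous ramp.
  move=> x; have [Dx _] := is_derive_ramp x.
  by apply: differentiable_continuous; exact/derivable1_diffP.
split; first by move=> x; have [] := D x.
split; last first.
  exists (Num.max `|c| `|d|) => x; rewrite gt_max => /andP[cx dx].
  apply: bump_eq0; apply/negP => /andP[c1 d1].
  have [x0|x0] := leP 0 x.
    by move: dx; rewrite (ger0_norm x0) ltNge (le_trans (ltW d1))// ler_norm.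
  move: cx; rewrite (ltr0_norm x0) ltNge -[`|c|]normrN.
  by rewrite (le_trans _ (ler_norm _))// lerN2 ltW.
have -> : derive1 (bump c d n) = fun x =>
    ramp (l x) * (ramp' (r x) * - n%:R) + ramp (r x) * (ramp' (l x) * n%:R).
  by apply/funext => x; rewrite derive1E; have [_ ->] := D x.
move=> x; apply: cvgD; apply: cvgM.
- exact: (@continuous_comp _ _ _ l ramp x (cl x) (cramp _)).
- apply: cvgMl.
  exact: (@continuous_comp _ _ _ r ramp' x (cr x) (@continuous_ramp' _)).
- exact: (@continuous_comp _ _ _ r ramp x (cr x) (cramp _)).
- apply: cvgMl.
  exact: (@continuous_comp _ _ _ l ramp' x (cl x) (@continuous_ramp' _)).
Qed.

End Bump.

(** * Integrals against bounded factors *)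

Section Integrals.
Set Implicit Arguments.
Unset Strict Implicit.
Variable R : realType.
Notation mu := (@lebesgue_measure R).
Variable D : set R.
Hypothesis mD : measurable (D : set (measurableTypeR R)).
Implicit Types (f g a y : R -> R) (x l : R).

Lemma integrable_bounded_mul a f L : continuous a -> (forall x, `|a x| <= L) ->
  mu.-integrable D (EFin \o f) -> mu.-integrable D (EFin \o (fun p => a p * f p)).
Proof.
move=> ca aL intf.
have -> : EFin \o (fun p => a p * f p) = ((EFin \o a) \* (EFin \o f))%E.
  by apply/funext => p /=; rewrite EFinM.
apply: integrableMr => //.
  exact: measurable_funS (continuous_measurable_fun ca).
exists L; split; first exact: num_real.
by move=> M LM x _; exact: (le_trans (aL x) (ltW LM)).
Qed.

Lemma integrable_lin (f g : R -> R) (r : R) : mu.-integrable D (EFin \o f) ->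
  mu.-integrable D (EFin \o g) ->
  mu.-integrable D (EFin \o (fun p => f p + r * g p)).
Proof.
move=> intf intg.
have -> : EFin \o (fun p => f p + r * g p) = ((EFin \o f) \+ (fun p => r%:E * (EFin \o g) p))%E.
  by apply/funext => p /=; rewrite EFinD EFinM.
by apply: integrableD => //; exact: integrableZl.
Qed.

Lemma integrable_subr f g : mu.-integrable D (EFin \o f) ->
  mu.-integrable D (EFin \o g) -> mu.-integrable D (EFin \o (fun p => f p - g p)).
Proof.
move=> intf intg; have -> : EFin \o (fun p => f p - g p) = ((EFin \o f) \- (EFin \o g))%E.
  by apply/funext => p /=; rewrite EFinB.
exact: integrableB.
Qed.

Lemma Rintegral_bounded_mul_le a f L : continuous a -> (forall x, `|a x| <= L) ->
  mu.-integrable D (EFin \o f) ->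
  `| \int[mu]_(p in D) (a p * f p) | <= L * \int[mu]_(p in D) `|f p|.
Proof.
move=> ca aL intf; have intaf := integrable_bounded_mul ca aL intf.
rewrite (le_trans (le_normr_Rintegral mD intaf))//.
rewrite -RintegralZl//; last exact: integrable_norm.
apply: le_Rintegral => //; first exact: integrable_norm.
  have -> : EFin \o (fun p => L * `|f p|) = (fun p => L%:E * (EFin \o (fun q => `|f q|)%R) p)%E.
    by apply/funext => p /=; rewrite EFinM.
  by apply: integrableZl => //; exact: integrable_norm.
by move=> x _; rewrite normrM ler_wpM2r.
Qed.

Lemma integrable_fsum (I : finType) (c : I -> R) (h : I -> R -> R) :
  (forall i, mu.-integrable D (EFin \o h i)) ->
  mu.-integrable D (EFin \o (fun p => \sum_i c i * h i p)).
Proof.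
move=> inth.
have -> : EFin \o (fun p => \sum_i c i * h i p) =
    (fun p => \sum_i (c i)%:E * (EFin \o h i) p)%E.
  by apply/funext => p /=; rewrite sumEFin.
by apply: integrable_sum => // i _; exact: integrableZl.
Qed.


Lemma Rintegral_fsum (I : finType) (c : I -> R) (h : I -> R -> R) :
  (forall i, mu.-integrable D (EFin \o h i)) ->
  \int[mu]_(p in D) (\sum_i c i * h i p) = \sum_i c i * \int[mu]_(p in D) h i p.
Proof.
move=> inth; rewrite /Rintegral.
under eq_integral do rewrite -sumEFin.
rewrite integral_sum//=; last first.
  by move=> i; apply: (eq_integrable mD (fun p => (c i)%:E * (EFin \o h i) p)%E) => //; exact: integrableZl.
rewrite -sum_fine => [|i _].
  by apply: eq_bigr => i _; exact: RintegralZl mD (inth i).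
apply: integrable_fin_num => //.
by apply: (eq_integrable mD (fun p => (c i)%:E * (EFin \o h i) p)%E) => //; exact: integrableZl.
Qed.

End Integrals.

(** * Time derivative of a pairing with a translating test function *)

Section MovingTestFunction.
Set Implicit Arguments.
Unset Strict Implicit.
Variable R : realType.
Notation mu := (@lebesgue_measure R).
Variable D : set R.
Hypothesis mD : measurable (D : set (measurableTypeR R)).
Variables (a : R -> R) (lam : R) (y : R -> R -> R) (x r : R).
Hypothesis Ca : C1c a.
Hypothesis r0 : 0 < r.
Hypothesis inty : forall s, `|s - x| < r -> mu.-integrable D (EFin \o y s).
Hypothesis conty : forall e, 0 < e -> exists2 d, 0 < d &
  forall s, `|s - x| < d -> \int[mu]_(p in D) `|y s p - y x p| < e.

Let m s p : R := a (p - lam * (s - x)).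

Let mE s : m s = fun p => a (p + - (lam * (s - x))). Proof. by []. Qed.

Let is_derive_m p s : is_derive s (1 : R) (m ^~ p) (- lam * derive1 a (p - lam * (s - x))).
Proof.
have Dh : is_derive s (1 : R) (fun s => p - lam * (s - x)) (- lam).
  have D1 : is_derive s (1 : R) (fun s => s - x) (1 - 0) by exact: is_deriveB.
  have D2 : is_derive s (1 : R) (fun s => p - lam * (s - x)) _ :=
    is_deriveB (is_derive_cst p s (1 : R)) (is_deriveZ lam D1).
  by apply: (is_derive_eq D2); rewrite sub0r subr0 /GRing.scale /= mulr1.
have := @is_derive1_comp R a (fun s => p - lam * (s - x)) s _ _ (C1c_is_derive _ Ca) Dh.
by rewrite mulrC.
Qed.

(** A product rule in which only one factor is differentiable pointwise: [y] has a time derivative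
    only after pairing with the fixed [a]. Its L^1 continuity at [x] absorbs the mixed term. *)
Lemma is_derive_moving l :
  is_derive x (1 : R) (fun s => \int[mu]_(p in D) (a p * y s p)) l ->
  is_derive x (1 : R) (fun s => \int[mu]_(p in D) (a (p - lam * (s - x)) * y s p))
    (l - lam * \int[mu]_(p in D) (derive1 a p * y x p)).
Proof.
move=> Dl.
have [L L0 aL] := C1c_derive1_bounded Ca.
have [K K0 aK] := C1c_bounded Ca.
have inty0 : mu.-integrable D (EFin \o y x) by apply: inty; rewrite subrr normr0.
have cm s : continuous (m s) by rewrite mE; apply: C1c_continuous; exact: C1c_shift.
have mK s p : `|m s p| <= K by exact: aK.
have m0 : m x = a by apply/funext => p; rewrite /m subrr mulr0 subr0.
have intm s s' : `|s' - x| < r -> mu.-integrable D (EFin \o (fun p => m s p * y s' p)).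
  by move=> s'r; apply: integrable_bounded_mul (inty s'r).
(* [m_s y_s - a y_x = (m_s - a)(y_s - y_x) + (m_s - a) y_x + a (y_s - y_x)]: the
   first term is o(s - x) and the second is differentiated under the integral. *)
pose F1 s := \int[mu]_(p in D) ((m s p - m x p) * (y s p - y x p)).
have DF1 : is_derive x (1 : R) F1 0.
  have F10 : F1 x = 0.
    rewrite /F1; under eq_Rintegral do rewrite subrr mul0r.
    by rewrite Rintegral_cst// mul0r.
  apply: is_derive_littleo => e e0.
  (* [L * |lam|] is a Lipschitz constant in time of the moving test function; adding 1 makes [e / C]
     meaningful when it vanishes. *)
  pose C := L * `|lam| + 1.
  have C0 : 0 < C by rewrite ltr_wpDl ?mulr_ge0.
  have [d d0 Hd] := conty (divr_gt0 e0 C0).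
  exists (Num.min r d) => [|s]; first by rewrite lt_min r0.
  rewrite lt_min => /andP[sr sd]; rewrite F10 mul0r !subr0.
  have mm p : `|m s p - m x p| <= L * `|lam| * `|s - x|.
    rewrite (le_trans (C1c_lipschitz Ca aL _ _))//.
    have -> : p - lam * (s - x) - (p - lam * (x - x)) = - (lam * (s - x)) by ring.
    by rewrite normrN normrM mulrA.
  have cmm : continuous (fun p => m s p - m x p).
    by move=> p; apply: cvgB; exact: cm.
  apply: (le_trans (Rintegral_bounded_mul_le mD cmm mm (integrable_subr mD (inty sr) inty0))).
  rewrite (@le_trans _ _ (C * `|s - x| * (e / C)))//.
    apply: ler_pM; rewrite ?mulr_ge0 ?Rintegral_ge0//; last exact/ltW/Hd.
    by rewrite ler_wpM2r// lerDl.
  by rewrite mulrAC [C * _]mulrC divfK// lt0r_neq0.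
pose F2 s := \int[mu]_(p in D) (m s p * y x p).
have DF2 : is_derive x (1 : R) F2 (- lam * \int[mu]_(p in D) (derive1 a p * y x p)).
  pose f s p := m s p * y x p.
  have Df s p : is_derive s (1 : R) (f ^~ p) (- lam * derive1 a (p - lam * (s - x)) * y x p).
    have Dm := is_deriveM (is_derive_m p s) (is_derive_cst (y x p) s (1 : R)).
    by apply: (is_derive_eq Dm); rewrite scaler0 add0r /GRing.scale /= mulrC.
  have -> : - lam * \int[mu]_(p in D) (derive1 a p * y x p) =
            \int[mu]_(p in D) (partial1of2 f x p).
    rewrite -RintegralZl//; last first.
      by apply: (integrable_bounded_mul mD _ aL) => //; case: Ca => _ [].
    apply: eq_Rintegral => p _; rewrite partial1of2E.
    by have [_ ->] := Df x p; rewrite subrr mulr0 subr0 mulrA.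
  (* Here [y] is frozen at time [x], so only the test function depends on [s]. Translation keeps the
     bound [L] on [derive1 a], so the majorant is uniform in [s] and the window [(x - 1, x + 1)] is
     arbitrary. *)
  apply: is_derive_cvg.
  apply: (@cvg_differentiation_under_integral R _ _ mu f D mD x (x - 1) (x + 1) _ _ _
    (fun p => L * `|lam| * `|y x p|)) => /=.
  - by rewrite in_itv /= ltrBlDr ltrDl ltr01.
  - by move=> s _; apply: intm; rewrite subrr normr0.
  - by move=> s p _ _; have [] := Df s p.
  - by move=> p; rewrite !mulr_ge0.
  - have := integrableZl mD (L * `|lam|) (integrable_norm inty0).
    by apply: eq_integrable => // p _ /=; rewrite EFinM.
  - move=> s p _ _; rewrite partial1of2E; have [_ ->] := Df s p.
    by rewrite !normrM normrN ler_wpM2r// mulrC ler_wpM2r.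
pose F0 s := F1 s + F2 s + \int[mu]_(p in D) (a p * y s p) - \int[mu]_(p in D) (a p * y x p).
have DF0 : is_derive x (1 : R) F0 (0 + (- lam * \int[mu]_(p in D) (derive1 a p * y x p)) + l - 0).
  by apply: is_deriveB.
have -> : l - lam * \int[mu]_(p in D) (derive1 a p * y x p) =
   0 + (- lam * \int[mu]_(p in D) (derive1 a p * y x p)) + l - 0.
  by rewrite add0r subr0 addrC mulNr.
apply: near_eq_is_derive DF0.
near=> s.
have sr : `|s - x| < r.
  by near: s; exists r => // s /=; rewrite distrC.
rewrite /F0 /F1 /F2.
have xr : `|x - x| < r by rewrite subrr normr0.
have -> : (fun p => (m s p - m x p) * (y s p - y x p)) =
   (fun p => (m s p * y s p - m s p * y x p) - (m x p * y s p - m x p * y x p)).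
  by apply/funext => p; ring.
rewrite RintegralB//; [|by apply: integrable_subr => //; exact: intm..].
rewrite RintegralB//; [|exact: intm|exact: intm].
rewrite RintegralB//; [|exact: intm|exact: intm].
rewrite m0 /m; ring.
Unshelve. all: by end_near. Qed.

End MovingTestFunction.

(** * Finite speed of propagation for diagonal transport systems *)

(** The primitive of [f] extended by zero is constant on []u, v[], and Lebesgue's differentiation
    theorem recovers [f] from it almost everywhere. *)
Lemma ae_eq0_itv (R : realType) (f : R -> R) (u v : R) :
  lebesgue_measure.-integrable (`]u, v[%classic : set (measurableTypeR R)) (EFin \o f) ->
  (forall c d, u < c -> d < v -> \int[lebesgue_measure]_(p in `]c, d[) f p = 0) ->
  {ae lebesgue_measure, forall p, u < p < v -> f p = 0}.
Proof.
move=> intf H.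
have muv : measurable (`]u, v[%classic : set (measurableTypeR R)) by exact: measurable_itv.
pose g := f \_ `]u, v[.
have intg : lebesgue_measure.-integrable setT (EFin \o g).
  by rewrite /g -restrict_EFin; apply/integrable_restrict => //=; rewrite setTI.
have intgS A : measurable (A : set (measurableTypeR R)) -> lebesgue_measure.-integrable A (EFin \o g).
  by move=> mA; exact: integrableS intg.
have locg : locally_integrable [set: R] g by apply: open_integrable_locally => //; exact: openT.
pose F x := \int[lebesgue_measure]_(t in `]-oo, x]) g t.
have Fcst c d : u < c -> c <= d -> d < v -> F d = F c.
  move=> uc cd dv; apply/eqP; rewrite -subr_eq0; apply/eqP.
  rewrite /F (@Rintegral_itvB R g -oo%O (BRight d) c)//; last exact: intgS.
  rewrite -Rintegral_itv_bndo_bndc; last exact: intgS.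
  rewrite -[RHS](H c d uc dv); apply: eq_Rintegral => p; rewrite inE /= in_itv /= => /andP[cp pd].
  by rewrite /g patchE mem_set//= in_itv /= (lt_trans uc)// (lt_trans pd).
have := @FTC1Ny R g (fun z => intgS _ (measurable_itv _)) locg.
apply: filterS; first exact: (ae_filter_ringOfSetsType lebesgue_measure).
move=> x [_ F'x] /andP[ux xv].
have gf : g x = f x by rewrite /g patchE mem_set//= in_itv /= ux.
rewrite -gf -F'x derive1E.
suff : is_derive x (1 : R) F 0 by case.
apply: (@near_eq_is_derive _ _ _ (cst (F x))) => //.
near=> s.
have us : u < s by near: s; exact: lt_nbhsr.
have sv : s < v by near: s; exact: lt_nbhsl.
have [xs|/ltW sx] := leP x s; first by rewrite (Fcst x s).
by rewrite (Fcst s x).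
Unshelve. all: by end_near. Qed.

Section Propagation.
Set Implicit Arguments.
Unset Strict Implicit.
Variable R : realType.
Notation mu := (@lebesgue_measure R).

Variables (J : finType) (y : J -> R -> R -> R) (lam : J -> R) (B : J -> J -> R).
Variables (T Rb lp lm : R).
Hypothesis T0 : 0 < T.
Hypotheses (lp0 : 0 <= lp) (lm0 : 0 <= lm).
Hypothesis lam_bound : forall k, - lm <= lam k <= lp.
Let D : set R := `]0, Rb[.
Hypothesis inty : forall k s, 0 <= s <= T -> mu.-integrable D (EFin \o y k s).
Hypothesis conty : forall k s0, 0 <= s0 <= T -> forall e, 0 < e ->
  exists2 d, 0 < d & forall s, 0 <= s <= T -> `|s - s0| < d ->
    \int[mu]_(p in D) `|y k s p - y k s0 p| < e.
Hypothesis weaky : forall k a, C1c a -> (forall p, ~~ (0 < p < Rb) -> a p = 0) ->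
  forall s, 0 < s < T ->
  is_derive s (1 : R) (fun s => \int[mu]_(p in D) (a p * y k s p))
   (lam k * \int[mu]_(p in D) (derive1 a p * y k s p) +
    \sum_l B k l * \int[mu]_(p in D) (a p * y l s p)).
Hypothesis y0 : forall k, {ae mu, forall p, D p -> y k 0 p = 0}.

Let mD : measurable (D : set (measurableTypeR R)).
Proof. exact: measurable_itv. Qed.

(** The support lies in the slice at time [s] of the domain of determinacy of [(0, Rb)], whose ends
    move inwards at the extreme speeds. The sup norm is the one dual to the L^1 control of [y]. *)
Definition cone_test (s : R) (a : R -> R) : Prop :=
  [/\ C1c a, (forall p, `|a p| <= 1) &
      forall p, ~~ (lp * s < p < Rb - lm * s) -> a p = 0].

(** The support moves by at most [lp * (t - s)] to the left and [lm * (t - s)] to the right, which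
    is exactly what the slice gains at each end going back from [t] to [s]. *)
Lemma cone_test_shift k (s t : R) a : 0 <= s <= t -> cone_test t a ->
  cone_test s (fun p => a (p + - (lam k * (s - t)))).
Proof.
move=> /andP[s0 st] [Ca a1 a0]; split => [|p|p Hp].
- exact: C1c_shift.
- exact: a1.
- apply: a0; apply: contra Hp => /andP[H1 H2].
  have /andP[L1 L2] := lam_bound k.
  have ts : 0 <= t - s by rewrite subr_ge0.
  have := ler_wpM2r ts L1; have := ler_wpM2r ts L2.
  by move=> H3 H4; apply/andP; split; nra.
Qed.

Lemma cone_test_support (s : R) a : 0 <= s -> cone_test s a ->
  forall p, ~~ (0 < p < Rb) -> a p = 0.
Proof.
move=> s0 [_ _ a0] p Hp; apply: a0; apply: contra Hp => /andP[H1 H2].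
apply/andP; split; first by rewrite (le_lt_trans _ H1)// mulr_ge0.
by rewrite (lt_le_trans H2)// gerBl mulr_ge0.
Qed.

(** The L^1 norm is continuous on the compact [[0, T]]. This provides the constant from which the
    halving starts. *)
Lemma Rintegral_norm_bounded k : exists2 K : R, 0 <= K &
  forall s, 0 <= s <= T -> \int[mu]_(p in D) `|y k s p| <= K.
Proof.
have cn : {within `[0, T], continuous (fun s => \int[mu]_(p in D) `|y k s p|)}.
  apply: continuous_within_itvcc => s0 s0T e e0.
  have [d d0 Hd] := conty k s0T e0; exists d => // s sT ss0.
  apply: le_lt_trans (Hd s sT ss0).
  have iy := inty k sT; have iy0 := inty k s0T.
  rewrite -RintegralB//; [|exact: integrable_norm..].
  have int1 : mu.-integrable D (EFin \o (fun p => `|y k s p| - `|y k s0 p|)).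
    by apply: (integrable_subr mD); exact: integrable_norm.
  rewrite (le_trans (le_normr_Rintegral mD int1))//.
  apply: le_Rintegral => //; first exact: integrable_norm.
    apply: (@integrable_norm _ _ _ mu D (fun p => y k s p - y k s0 p)).
    exact: integrable_subr.
  by move=> p _; exact: ler_dist_dist.
have [c c0T Hc] := EVT_max (ltW T0) cn.
exists (\int[mu]_(p in D) `|y k c p|); first by apply: Rintegral_ge0.
by move=> s sT; apply: Hc; rewrite in_itv.
Qed.

(** Bounds every row sum of [|B|] at once; the summand 1 keeps it positive even for [B = 0], as
    [exp_derive_bound] requires. *)
Let C : R := 1 + \sum_k \sum_l `|B k l|.

Let C_gt0 : 0 < C.
Proof. by rewrite ltr_wpDr// sumr_ge0// => k _; rewrite sumr_ge0. Qed.

Let BC k : \sum_l `|B k l| <= C.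
Proof.
rewrite /C [X in _ + X](bigD1 k)//= addrCA lerDl addr_ge0//.
by rewrite sumr_ge0// => i _; rewrite sumr_ge0.
Qed.

(** All components, times and tests share one constant: differentiating the pairing for [k] produces
    pairings of the same test with every other component, so only a simultaneous bound reproduces
    itself. *)
Definition cone_bound (K : R) := forall k t a, 0 <= t <= T -> cone_test t a ->
  `|\int[mu]_(p in D) (a p * y k t p)| <= K * expR (2 * C * t).

Lemma cone_bound_exists : exists2 K : R, 0 <= K & cone_bound K.
Proof.
pose K k := xget 0 [set K : R | 0 <= K /\
  forall s, 0 <= s <= T -> \int[mu]_(p in D) `|y k s p| <= K].
have HK k : 0 <= K k /\
  forall s, 0 <= s <= T -> \int[mu]_(p in D) `|y k s p| <= K k.
  have [K0 K00 HK0] := Rintegral_norm_bounded k.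
  by rewrite /K; case: xgetP => [_ -> //|/(_ K0)]; case.
exists (\sum_k K k); first by apply: sumr_ge0 => k _; case: (HK k).
move=> k t a t0T [Ca a1 _].
have ca := C1c_continuous Ca.
rewrite (le_trans (Rintegral_bounded_mul_le mD ca a1 (inty k t0T)))// mul1r.
have [K0 Kt] := HK k.
rewrite (le_trans (Kt t t0T))//.
have KK : K k <= \sum_k K k.
  rewrite (bigD1 k)//= lerDl; apply: sumr_ge0 => i _; by case: (HK i).
rewrite (le_trans KK)// ler_peMr//; first exact: le_trans KK.
rewrite -expR0 ler_expR mulr_ge0//; last by case/andP: t0T.
by rewrite mulr_ge0// ltW.
Qed.

(** Gronwall's argument as a contraction: in the norm weighted by [e^{-2Ct}], one integration in
    time gains the factor 1/2 on all of [[0, T]], whatever the size of [T]. *)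
Lemma cone_bound_half (K : R) : 0 <= K -> cone_bound K -> cone_bound (K / 2).
Proof.
move=> K0 HK k t a /andP[t0 tT] Ta.
have [Ca a1 a0] := Ta.
have ca := C1c_continuous Ca.
have [L L0 aL] := C1c_derive1_bounded Ca.
pose a_ (s p : R) := a (p + - (lam k * (s - t))).
have Ts s : 0 <= s <= t -> cone_test s (a_ s) by move=> st; exact: cone_test_shift.
have Cas s : C1c (a_ s) by exact: C1c_shift.
have cas s : continuous (a_ s) by exact: C1c_continuous.
have as1 s p : `|a_ s p| <= 1 by exact: a1.
pose f s := \int[mu]_(p in D) (a_ s p * y k s p).
pose df s := \sum_l B k l * \int[mu]_(p in D) (a_ s p * y l s p).
have inT s : 0 <= s <= t -> 0 <= s <= T.
  by move=> /andP[-> /=] /le_trans; apply.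
have -> : \int[mu]_(p in D) (a p * y k t p) = f t.
  by apply: eq_Rintegral => p _; rewrite /a_ subrr mulr0 oppr0 addr0.
have f0 : f 0 = 0.
  have st0 : (0 : R) <= 0 <= T by apply/andP; split; [exact: lexx|exact: ltW].
  have inta : mu.-integrable D (EFin \o (fun p => a_ 0 p * y k 0 p)).
    exact (integrable_bounded_mul mD (cas 0) (as1 0) (inty k st0)).
  rewrite /f /Rintegral (@ae_eq_integral _ _ _ mu D (cst 0%E)) ?integral0//.
    by case/integrableP : inta.
  move: (y0 k); apply: filterS; first exact: (ae_filter_ringOfSetsType mu).
  move=> p Hp Dp /=.
  by rewrite Hp// mulr0.
have fc : {within `[0, t], continuous f}.
  apply: continuous_within_itvcc => s0 s0t e e0.
  have s0T := inT _ s0t.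
  have e20 : 0 < e / 2 by rewrite divr_gt0.
  have [d d0 Hd] := conty k s0T e20.
  pose M := L * `|lam k| * (\int[mu]_(p in D) `|y k s0 p|) + 1.
  have M0 : 0 < M by rewrite ltr_wpDl// !mulr_ge0// Rintegral_ge0.
  exists (Num.min d (e / 2 / M)); first by rewrite lt_min d0 divr_gt0.
  move=> s st; rewrite lt_min => /andP[sd sM].
  have sT := inT _ st.
  have iy := inty k sT; have iy0 := inty k s0T.
  have iB := integrable_subr mD iy iy0.
  have fB : f s - f s0 = \int[mu]_(p in D) (a_ s p * (y k s p - y k s0 p)) +
      \int[mu]_(p in D) ((a_ s p - a_ s0 p) * y k s0 p).
    have E1 : \int[mu]_(p in D) (a_ s p * (y k s p - y k s0 p)) =
       f s - \int[mu]_(p in D) (a_ s p * y k s0 p).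
      rewrite -RintegralB//; first last.
      - exact (integrable_bounded_mul mD (cas s) (as1 s) iy0).
      - exact (integrable_bounded_mul mD (cas s) (as1 s) iy).
      by apply: eq_Rintegral => p _; rewrite mulrBr.
    have E2 : \int[mu]_(p in D) ((a_ s p - a_ s0 p) * y k s0 p) =
       \int[mu]_(p in D) (a_ s p * y k s0 p) - f s0.
      rewrite -RintegralB//; first last.
      - exact (integrable_bounded_mul mD (cas s0) (as1 s0) iy0).
      - exact (integrable_bounded_mul mD (cas s) (as1 s) iy0).
      by apply: eq_Rintegral => p _; rewrite mulrBl.
    by rewrite E1 E2 addrA subrK.
  have asL p : `|a_ s p - a_ s0 p| <= L * `|lam k| * `|s - s0|.
    rewrite (le_trans (C1c_lipschitz Ca aL _ _))//.
    have -> : p + - (lam k * (s - t)) - (p + - (lam k * (s0 - t))) = - (lam k * (s - s0)) by ring.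
    by rewrite normrN normrM mulrA.
  have cB : continuous (fun p => a_ s p - a_ s0 p).
    by move=> p; apply: cvgB; exact: cas.
  rewrite fB (le_lt_trans (ler_normD _ _))// [ltRHS](splitr e); apply: ltr_leD.
    apply: (le_lt_trans (Rintegral_bounded_mul_le mD (cas s) (as1 s) iB)).
    by rewrite mul1r; exact: Hd.
  apply: (le_trans (Rintegral_bounded_mul_le mD cB asL iy0)).
  move: sM; rewrite ltr_pdivlMr// => sM; apply: le_trans (ltW sM).
  rewrite mulrAC mulrC ler_wpM2l// /M.
  by rewrite lerDl.
have fD s : 0 < s < t -> is_derive s (1 : R) f (df s).
  move=> /andP[s0 st].
  have s0t : 0 <= s <= t by rewrite !ltW.
  have s0T := inT _ s0t.
  have sT : 0 < s < T by rewrite s0 (lt_le_trans st).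
  have supp : forall p, ~~ (0 < p < Rb) -> a_ s p = 0.
    by apply: (cone_test_support (ltW s0)); exact: Ts.
  have Dw := weaky k (Cas s) supp sT.
  (* Integrability and continuity of [y] are known only for times in [[0, T]]; this radius keeps
     [s'] there. *)
  pose r := Num.min s (T - s).
  have r0 : 0 < r by rewrite lt_min s0 subr_gt0; case/andP: sT.
  have rT s' : `|s' - s| < r -> 0 <= s' <= T.
    rewrite lt_min => /andP[]; rewrite !ltr_norml => /andP[H1 _] /andP[_ H2].
    by apply/andP; split; lra.
  have ir s' : `|s' - s| < r -> mu.-integrable D (EFin \o y k s').
    by move=> /rT; exact: inty.
  have cr e : 0 < e -> exists2 d, 0 < d &
      forall s', `|s' - s| < d -> \int[mu]_(p in D) `|y k s' p - y k s p| < e.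
    move=> e0; have [d d0 Hd] := conty k s0T e0.
    exists (Num.min r d); first by rewrite lt_min r0.
    by move=> s'; rewrite lt_min => /andP[/rT s'T s'd]; exact: Hd.
  have := is_derive_moving mD (lam k) (Cas s) r0 ir cr Dw.
  rewrite [X in is_derive _ _ _ (X - _)]addrC addrK.
  suff -> : f = fun s' => \int[mu]_(p in D) (a_ s (p - lam k * (s' - s)) * y k s' p) by [].
  apply/funext => s'; apply: eq_Rintegral => p _.
  congr (a _ * _); ring.
apply: (@exp_derive_bound R f df t C K t0 C_gt0 K0 f0 fc fD) => s /andP[s0 st].
have s0t : 0 <= s <= t by rewrite !ltW.
rewrite (le_trans (ler_norm_sum _ _ _))//.
apply: (@le_trans _ _ (\sum_l `|B k l| * (K * expR (2 * C * s)))).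
  apply: ler_sum => l _; rewrite normrM ler_wpM2l//.
  by apply: HK; [exact: inT|exact: Ts].
by rewrite -mulr_suml ler_wpM2r// mulr_ge0// expR_ge0.
Qed.

Lemma cone_test_Rintegral_eq0 k a : cone_test T a ->
  \int[mu]_(p in D) (a p * y k T p) = 0.
Proof.
move=> Ta; have [K K0 HK] := cone_bound_exists.
have HKn n : cone_bound (K / 2 ^+ n).
  elim: n => [|n IHn]; first by rewrite expr0 divr1.
  by rewrite exprSr invfM mulrA; apply: cone_bound_half => //; rewrite divr_ge0 ?exprn_ge0.
have TT : 0 <= T <= T by apply/andP; split; [exact: ltW|exact: lexx].
set I := \int[mu]_(p in D) _.
have I0 : `|I| <= 0.
  have cvg0 : K / 2 ^+ n * expR (2 * C * T) @[n --> \oo] --> (0 : R).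
    rewrite (_ : 0 = K * 0 * expR (2 * C * T)); last by rewrite mulr0 mul0r.
    apply: cvgMl; apply: cvgMr.
    under eq_fun do rewrite -exprVn.
    by apply: cvg_expr; rewrite ger0_norm ?invr_ge0// invf_lt1// ltr1n.
  rewrite leNgt; apply/negP => I0.
  have /cvgr_lt /(_ _ I0) [n _ /(_ n (leqnn n))] := cvg0.
  by move=> /=; rewrite ltNge (HKn n k T a TT Ta).
by apply/eqP; rewrite -normr_le0.
Qed.

(** Dominated convergence, with majorant [|y k T|], carries the vanishing from the bumps of []c,
    d[], which are cone tests at time [T], to the indicator. *)
Lemma cone_itv_Rintegral_eq0 k c d : lp * T < c -> d < Rb - lm * T ->
  \int[mu]_(p in `]c, d[) y k T p = 0.
Proof.
move=> cT dT.
have TT : 0 <= T <= T by apply/andP; split; [exact: ltW|exact: lexx].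
have iy := inty k TT.
have lpT : 0 <= lp * T by rewrite mulr_ge0// ltW.
have lmT : 0 <= lm * T by rewrite mulr_ge0// ltW.
have bump_test n : cone_test T (bump c d n).
  split=> [|p|p Hp]; first exact: C1c_bump.
    by rewrite ger0_norm ?bump_ge0// bump_le1.
  apply: bump_eq0; apply: contra Hp => /andP[H1 H2].
  by rewrite (lt_trans cT H1) (lt_trans H2 dT).
have cdD : `]c, d[%classic `<=` D.
  move=> p /=; rewrite !in_itv /= => /andP[H1 H2]; apply/andP; split.
    exact: (lt_trans (le_lt_trans lpT cT) H1).
  have RT : Rb - lm * T <= Rb by rewrite gerBl.
  exact: (lt_trans H2 (lt_le_trans dT RT)).
have -> : \int[mu]_(p in `]c, d[) y k T p = \int[mu]_(p in D) ((y k T) \_ `]c, d[) p.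
  by rewrite -Rintegral_mkcondr; congr (Rintegral _ _ _); rewrite setIidr.
have ib n : mu.-integrable D (EFin \o (fun p => bump c d n p * y k T p)).
  have [Cb b1 _] := bump_test n.
  exact (integrable_bounded_mul mD (C1c_continuous Cb) b1 iy).
have mcd : measurable (`]c, d[%classic : set (measurableTypeR R)) by exact: measurable_itv.
have ir : mu.-integrable D (EFin \o ((y k T) \_ `]c, d[)).
  rewrite -restrict_EFin; apply/integrable_restrict => //.
  by apply: integrableS iy => //; exact: measurableI.
have Hf : {ae mu, forall p, D p -> (bump c d n p * y k T p)%:E @[n --> \oo] -->
    (((y k T) \_ `]c, d[) p)%:E}.
  apply: aeW => p _; apply: cvg_EFin; first exact: nearW.
  rewrite patchE; case: ifPn => pcd.
    rewrite -[X in _ --> X]mul1r; apply: cvgMl; apply: bump_cvg.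
    by move: pcd; rewrite inE /= in_itv.
  have b0 n : bump c d n p = 0.
    by apply: bump_eq0; apply: contra pcd => pcd; rewrite inE /= in_itv.
  by under eq_fun do rewrite b0 mul0r; exact: cvg_cst.
have Hg : {ae mu, forall p n, D p ->
    (`|(bump c d n p * y k T p)%:E| <= `|(y k T p)%:E|)%E}.
  apply: aeW => p n _; rewrite lee_fin normrM ler_piMl//.
  by have [_ + _] := bump_test n; apply.
have [_ _] := dominated_convergence mD (fun n => measurable_int mu (ib n))
  (measurable_int mu ir) Hf (integrable_abse iy) Hg.
have b0 n : (\int[mu]_(p in D) (bump c d n p * y k T p)%:E = 0)%E.
  rewrite -[LHS]fineK; last exact (integrable_fin_num mD (ib n)).
  by congr (_%:E); exact: cone_test_Rintegral_eq0 (bump_test n).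
have -> : [sequence (\int[mu]_(p in D) (EFin \o (fun p => bump c d n p * y k T p)%R) p)%E]_n
    = cst 0%E.
  by apply/funext => n; exact: b0.
move=> /cvg_lim cv0; have := cv0 (@ereal_hausdorff R).
by rewrite lim_cst; [move=> E0; rewrite /Rintegral -E0|exact: ereal_hausdorff].
Qed.

Lemma propagation : {ae mu, forall p, lp * T < p < Rb - lm * T ->
  forall k, y k T p = 0}.
Proof.
have TT : 0 <= T <= T by apply/andP; split; [exact: ltW|exact: lexx].
have H k : {ae mu, forall p, lp * T < p < Rb - lm * T -> y k T p = 0}.
  apply: ae_eq0_itv; last exact: cone_itv_Rintegral_eq0.
  apply: (integrableS mD _ _ (inty k TT)); first exact: measurable_itv.
  apply: subset_itv; rewrite bnd_simp.
    by rewrite mulr_ge0// ltW.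
  by rewrite gerBl mulr_ge0// ltW.
have : {ae mu, forall p k, lp * T < p < Rb - lm * T -> y k T p = 0}.
  have aeF := ae_filter_ringOfSetsType mu.
  by apply: filter_forall => k; exact: H.
apply: filterS; first exact: (ae_filter_ringOfSetsType mu).
by move=> p Hp pT k; exact: Hp.
Qed.

End Propagation.

(** * Diagonalization and extreme eigenvalues *)

Section Spectral.
Set Implicit Arguments.
Unset Strict Implicit.
Variables (R : realType) (N : nat).
Implicit Types (H : 'M[R[i]]_N).

(** The spectral theorem, in the form that decouples the transport term upon left multiplication by
    [P]. The spectrum being real, the [lam k] can serve as propagation speeds. *)
Lemma hermitian_diagonalization H : is_hermitian H ->
  exists2 P : 'M[R[i]]_N, P \in unitmx &
  exists lam : 'I_N -> R,
    P *m H = diag_mx (\row_k ((lam k)%:C)%C) *m P.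
Proof.
move=> Hherm.
have Hs : H \is hermsymmx.
  apply/is_hermitianmxP; rewrite expr0 scale1r.
  by apply/matrixP => i j; rewrite !mxE Hherm.
have [P [d [Pu HE dreal]]] : exists P (d : 'rV[R[i]]_N),
    [/\ P \in unitmx, H = invmx P *m diag_mx d *m P & forall k, d 0 k \is Num.real].
  exists (spectralmx H), (spectral_diag H); split; first exact: spectral_unit.
    by apply/orthomx_spectralP; exact: hermitian_normalmx.
  by move=> k; have /mxOverP := hermitian_spectral_diag_real Hs; apply.
exists P => //; exists (fun k => complex.Re (d 0 k)).
rewrite HE mulmxA mulKVmx; last exact: Pu.
by congr (diag_mx _ *m _); apply/rowP => k; rewrite mxE RRe_real.
Qed.

Variables (H P : 'M[R[i]]_N) (lam : 'I_N -> R).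
Hypothesis Pu : P \in unitmx.
Hypothesis PH : P *m H = diag_mx (\row_k ((lam k)%:C)%C) *m P.

Let eigenvalue_diag k : eigenvalue H ((lam k)%:C)%C.
Proof.
apply/eigenvalueP; exists (row k P).
  by rewrite -row_mul PH mul_diag_mx; apply/rowP => j; rewrite !mxE.
have : row_free P by rewrite row_free_unit.
move=> Pf; apply/eqP => Pk; have : delta_mx 0 k *m P = 0 :> 'rV_N by rewrite -rowE.
move/eqP; rewrite mulmx_free_eq0// => /eqP /rowP /(_ k) /eqP.
by rewrite !mxE !eqxx oner_eq0.
Qed.

(** A nonzero coordinate of [v *m invmx P] singles out [k]. The spectrum is thus bounded, which
    makes the suprema in [lam_pos_max] and [lam_neg_max] genuine. *)
Let eigenvalue_in_diag (x : R) : eigenvalue H (x%:C)%C -> exists k, x = lam k.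
Proof.
move=> /eigenvalueP[v vH v0].
pose u := v *m invmx P.
have uD : u *m diag_mx (\row_k ((lam k)%:C)%C) = (x%:C)%C *: u.
  have -> : diag_mx (\row_k ((lam k)%:C)%C) = P *m H *m invmx P.
    by rewrite PH mulmxK.
  by rewrite /u !mulmxA mulmxKV// vH scalemxAl.
have u0 : u != 0.
  apply: contra v0 => /eqP u0; apply/eqP.
  by rewrite -[v](mulmxKV Pu) -/u u0 mul0mx.
clearbody u; have /existsP[k uk] : [exists k, u 0 k != 0].
  apply: contraR u0 => /existsPn u0; apply/eqP/rowP => k; rewrite [RHS]mxE.
  by apply/eqP; move: (u0 k); rewrite negbK.
exists k; have /rowP /(_ k) := uD.
by rewrite mul_mx_diag !mxE mulrC => /(mulIf uk) /complexI.
Qed.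

Let has_sup_pos : has_sup ([set 0] `|` [set x : R | 0 < x /\ eigenvalue H (x%:C)%C]).
Proof.
split; first by exists 0; left.
exists (\sum_k `|lam k|) => x [->|[x0 /eigenvalue_in_diag[l ->]]].
  by apply: sumr_ge0.
by rewrite (bigD1 l)//= ler_wpDr ?ler_norm// sumr_ge0.
Qed.

Let has_sup_neg : has_sup ([set 0] `|` [set x : R | 0 < x /\ eigenvalue H ((- x)%:C)%C]).
Proof.
split; first by exists 0; left.
exists (\sum_k `|lam k|) => x [->|[x0 /eigenvalue_in_diag[l xl]]].
  by apply: sumr_ge0.
rewrite -[x]opprK xl (bigD1 l)//= ler_wpDr ?sumr_ge0// -normrN.
exact: ler_norm.
Qed.

Lemma lam_pos_max_ge0 : 0 <= lam_pos_max H.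
Proof. by apply: (sup_upper_bound has_sup_pos); left. Qed.

Lemma lam_neg_max_ge0 : 0 <= lam_neg_max H.
Proof. by apply: (sup_upper_bound has_sup_neg); left. Qed.

Lemma diag_lam_bound k : - lam_neg_max H <= lam k <= lam_pos_max H.
Proof.
apply/andP; split.
  rewrite lerNl; have [l0|l0] := leP (- lam k) 0.
    exact: le_trans lam_neg_max_ge0.
  by apply: (sup_upper_bound has_sup_neg); right; split => //; rewrite opprK.
have [l0|l0] := leP (lam k) 0; first exact: le_trans lam_pos_max_ge0.
by apply: (sup_upper_bound has_sup_pos); right.
Qed.

End Spectral.

(** * Real and imaginary parts *)

Section Parts.
Set Implicit Arguments.
Unset Strict Implicit.
Variable R : realType.
Implicit Types (c z : R[i]) (b : bool).

Definition part b z : R := if b then complex.Im z else complex.Re z.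

(** The entries of the real 2 by 2 matrix of multiplication by [c], with [false] indexing the real
    part and [true] the imaginary part. *)
Definition mulpart c b b' : R :=
  match b, b' with
  | false, true => - complex.Im c
  | true, false => complex.Im c
  | _, _ => complex.Re c
  end.

Lemma partB b z1 z2 : part b (z1 - z2) = part b z1 - part b z2.
Proof. by case: b; case: z1; case: z2. Qed.

Lemma partD b z1 z2 : part b (z1 + z2) = part b z1 + part b z2.
Proof. by case: b; case: z1; case: z2. Qed.

Lemma part0 b : part b 0 = 0.
Proof. by case: b. Qed.

Lemma part_sum b (I : finType) (F : I -> R[i]) :
  part b (\sum_i F i) = \sum_i part b (F i).
Proof. by apply: (big_morph (part b)) => [u v|]; [exact: partD|exact: part0]. Qed.

Lemma partZ b (r : R) z : part b ((r%:C)%C * z) = r * part b z.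
Proof.
by case: b; case: z => x y; rewrite /= ?mul0r ?subr0 ?addr0.
Qed.

Lemma part_mul b c z : part b (c * z) = \sum_b' mulpart c b b' * part b' z.
Proof.
rewrite big_bool; case: b; case: c => c1 c2; case: z => z1 z2 /=; ring.
Qed.

(** Realification: the pairs in ['I_n * bool] index the real coordinates of a complex vector, and
    supply the finite type [J] of the propagation argument. *)
Lemma part_mulmx b (m n : nat) (M : 'M[R[i]]_(m, n)) (v : 'cV[R[i]]_n) (k : 'I_m) :
  part b ((M *m v) k 0) =
  \sum_(j : 'I_n * bool) mulpart (M k j.1) b j.2 * part j.2 (v j.1 0).
Proof.
rewrite mxE part_sum -(pair_bigA _ (fun j b' => mulpart (M k j) b b' * part b' (v j 0)))/=.
by apply: eq_bigr => j _; exact: part_mul.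
Qed.

Lemma part_eq0 z : (forall b, part b z = 0) -> z = 0.
Proof.
case: z => x y H; apply/eqP; rewrite eq_complex.
by rewrite (H false : x = 0) (H true : y = 0) !eqxx.
Qed.

End Parts.

(** * Test functions supported in an interval *)

Section Support.
Set Implicit Arguments.
Unset Strict Implicit.
Variables (R : realType) (Rb : R).
Notation mu := (@lebesgue_measure R).
Let D : set R := `]0, Rb[.

Lemma Rintegral_support (f : R -> R) : (forall p, ~~ (0 < p < Rb) -> f p = 0) ->
  \int[mu]_p f p = \int[mu]_(p in D) f p.
Proof.
move=> f0; rewrite [RHS]Rintegral_mkcond; apply: eq_Rintegral => p _.
rewrite patchE; case: ifPn => // pD; apply: f0.
by apply: contra pD => pD; rewrite inE /D /= in_itv /=.
Qed.

(** Strictly outside the interval [a] vanishes in a neighbourhood. At the end points it need not,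
    and there the continuity of [derive1 a] decides, by comparison with points [d / 2] further
    out. *)
Lemma derive1_support (a : R -> R) : C1c a -> (forall p, ~~ (0 < p < Rb) -> a p = 0) ->
  forall p, ~~ (0 < p < Rb) -> derive1 a p = 0.
Proof.
move=> Ca a0 p Hp; apply: contrapT => /eqP ap.
have ca : {for p, continuous (derive1 a)} by case: Ca => _ [+ _]; exact.
have [d /= d0 Hd] := cvgr_neq0 _ ca ap.
have out (q : R) : (q < 0) || (Rb < q) -> derive1 a q = 0.
  move=> /orP[q0|qR]; apply: derive1_eq0_near.
    near=> z; apply: a0; rewrite negb_and -leNgt ltW//.
    by near: z; exact: lt_nbhsl.
  near=> z; apply: a0; rewrite negb_and orbC -leNgt ltW//.
  by near: z; exact: lt_nbhsr.
have d2 : 0 < d / 2 by rewrite divr_gt0.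
have d2d : d / 2 < d by rewrite ltr_pdivrMr// mulr_natr mulr2n ltrDr.
move: Hp; rewrite negb_and -!leNgt => /orP[p0|pR].
  have := Hd (p - d / 2); rewrite /ball_ /= opprB addrC subrK gtr0_norm// => /(_ d2d).
  by rewrite out ?eqxx// (_ : p - d / 2 < 0)// subr_lt0 (le_lt_trans p0).
have := Hd (p + d / 2); rewrite /ball_ /= opprD addrA subrr sub0r normrN gtr0_norm// => /(_ d2d).
by rewrite out ?eqxx// (_ : Rb < p + d / 2) ?orbT// (le_lt_trans pR)// ltrDl.
Unshelve. all: by end_near. Qed.

Hypothesis Rb0 : 0 < Rb.

Let continuous_expN : continuous (fun p : R => expR (- p)).
Proof. by move=> p; apply: continuous_comp; [exact: opp_continuous|exact: continuous_expR]. Qed.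

Let is_derive_expN (p : R) : is_derive p (1 : R) (fun p : R => expR (- p)) (- expR (- p)).
Proof.
have Dn : is_derive p (1 : R) (fun p : R => - p) (- 1) by exact: is_deriveN.
have := @is_derive1_comp R expR (fun p => - p) p _ _ (is_derive_expR (- p)) Dn.
by rewrite mulrN1.
Qed.

Lemma integrable_expN : mu.-integrable (D : set (measurableTypeR R)) (EFin \o (fun p : R => expR (- p))).
Proof.
have : mu.-integrable (`[0, Rb]%classic : set (measurableTypeR R)) (EFin \o (fun p : R => expR (- p))).
  apply: continuous_compact_integrable; first exact: segment_compact.
  exact: continuous_subspaceT.
apply: integrableS; [exact: measurable_itv|exact: measurable_itv|].
exact: subset_itv_oo_cc.
Qed.

(** The weak form of - d/dp e^{-p} = e^{-p}, by which the transport term acts on e^{-p} uf as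
    multiplication by [H1]. The boundary terms vanish with [a]. *)
Lemma Rintegral_derive1_expN (a : R -> R) : C1c a ->
  (forall p, ~~ (0 < p < Rb) -> a p = 0) ->
  \int[mu]_(p in D) (derive1 a p * expR (- p)) = \int[mu]_(p in D) (a p * expR (- p)).
Proof.
move=> Ca a0; have [_ [ca' _]] := Ca; have ca := C1c_continuous Ca.
(* Integration by parts is applied on the closed segment; adding the end points does not change the
   integrals. *)
have oc (f : R -> R) : continuous f ->
    \int[mu]_(p in D) (f p * expR (- p)) = \int[mu]_(p in `[0, Rb]) (f p * expR (- p)).
  move=> cf.
  have fi : mu.-integrable (`[0, Rb]%classic : set (measurableTypeR R))
      (EFin \o (fun p : R => f p * expR (- p))).
    apply: continuous_compact_integrable; first exact: segment_compact.
    by apply: continuous_subspaceT => p; apply: cvgM; [exact: cf|exact: continuous_expN].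
  rewrite -[RHS]Rintegral_itv_bndo_bndc; last first.
    by apply: integrableS fi; [exact: measurable_itv|exact: measurable_itv|exact: subset_itv_co_cc].
  rewrite -Rintegral_itv_obnd_cbnd//.
  by apply: integrableS fi; [exact: measurable_itv|exact: measurable_itv|exact: subset_itv_oo_cc].
rewrite !oc//.
under eq_Rintegral do rewrite mulrC.
rewrite (@Rintegration_by_parts R (fun p => expR (- p)) a (fun p => - expR (- p)) (derive1 a))//.
- rewrite !a0 ?ltxx ?andbF// !mulr0 subrr sub0r.
  rewrite -mulN1r -RintegralZl; last 2 first.
  + exact: measurable_itv.
  + apply: continuous_compact_integrable; first exact: segment_compact.
    apply: continuous_subspaceT => p; apply: cvgM; last exact: ca.
    by apply: cvgN; exact: continuous_expN.
  by apply: eq_Rintegral => p _; rewrite mulN1r mulNr opprK mulrC.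
- by apply: continuous_subspaceT => p; apply: cvgN; exact: continuous_expN.
- split.
  + by move=> p _; have [] := is_derive_expN p.
  + by apply: cvg_at_right_filter; exact: continuous_expN.
  + by apply: cvg_at_left_filter; exact: continuous_expN.
- by move=> p _; rewrite derive1E; have [_ ->] := is_derive_expN p.
- exact: continuous_subspaceT.
- split.
  + by move=> p _; case: Ca.
  + by apply: cvg_at_right_filter; exact: ca.
  + by apply: cvg_at_left_filter; exact: ca.
Qed.

End Support.

(** * From L^2 on the line to L^1 on a bounded interval *)

Section SquareIntegrable.
Set Implicit Arguments.
Unset Strict Implicit.
Variables (R : realType) (N : nat).
Notation mu := (@lebesgue_measure R).
Implicit Types (f g : R -> 'cV[R[i]]_N) (u v : 'cV[R[i]]_N).

Lemma vnorm2_ge0 u : 0 <= vnorm2 u.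
Proof. by apply: sumr_ge0 => j _; rewrite addr_ge0 ?sqr_ge0. Qed.

Lemma part_le_vnorm2 b u (j : 'I_N) : part b (u j 0) ^+ 2 <= vnorm2 u.
Proof.
rewrite /vnorm2 (bigD1 j)//= -[leLHS]addr0; apply: lerD.
  by case: b; rewrite /cnorm2 /= ?lerDr ?lerDl sqr_ge0.
by apply: sumr_ge0 => i _; rewrite addr_ge0 ?sqr_ge0.
Qed.

Lemma vnorm2B_le u v : vnorm2 (u - v) <= 2 * vnorm2 u + 2 * vnorm2 v.
Proof.
rewrite /vnorm2 !mulr_sumr -big_split; apply: ler_sum => j _; rewrite !mxE /cnorm2.
case: (u j 0) => a b; case: (v j 0) => c d /=.
have := sqr_ge0 (a + c); have := sqr_ge0 (b + d); nra.
Qed.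

Definition measurable_vec f := forall j b,
  measurable_fun (setT : set (measurableTypeR R)) (fun p => part b (f p j 0)).

Lemma measurable_vecB f g : measurable_vec f -> measurable_vec g ->
  measurable_vec (fun p => f p - g p).
Proof.
move=> mf mg j b.
have -> : (fun p => part b ((f p - g p) j 0)) = (fun p => part b (f p j 0) - part b (g p j 0)).
  by apply/funext => p; rewrite !mxE partB.
by apply: measurable_funB.
Qed.

Lemma measurable_vnorm2 f : measurable_vec f ->
  measurable_fun (setT : set (measurableTypeR R)) (fun p => vnorm2 (f p)).
Proof.
move=> mf; apply: measurable_sum => j.
by apply: measurable_funD; apply: measurable_funX; [exact: (mf j false)|exact: (mf j true)].
Qed.

Lemma L2vec_measurable f : L2vec f -> measurable_vec f.
Proof. by move=> [mf _] j [|]; [exact: (mf j).2|exact: (mf j).1]. Qed.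

Lemma integrable_vnorm2 f : L2vec f -> mu.-integrable setT (EFin \o (fun p => vnorm2 (f p))).
Proof.
move=> Lf; apply/integrableP; split.
  by apply/measurable_EFinP; apply: measurable_vnorm2; exact: L2vec_measurable.
case: Lf => _; apply: le_lt_trans; rewrite le_eqVlt; apply/orP; left; apply/eqP.
by apply: eq_integral => p _; rewrite /= ger0_norm// vnorm2_ge0.
Qed.

(** [L2dist2] is a real-valued integral, equal to 0 by convention if the integral were infinite;
    integrability is what lets its smallness control anything. *)
Lemma integrable_vnorm2B f g : L2vec f -> L2vec g ->
  mu.-integrable setT (EFin \o (fun p => vnorm2 (f p - g p))).
Proof.
move=> Lf Lg.
have i2 : mu.-integrable setT (EFin \o (fun p => 2 * vnorm2 (f p) + 2 * vnorm2 (g p))).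
  apply: integrable_lin => //; last exact: integrable_vnorm2.
  have := integrableZl measurableT 2 (integrable_vnorm2 Lf).
  by apply: eq_integrable => // p _ /=; rewrite EFinM.
apply: le_integrable i2 => //.
  apply/measurable_EFinP; apply: measurable_vnorm2.
  by apply: measurable_vecB; exact: L2vec_measurable.
move=> p _ /=; rewrite lee_fin !ger0_norm ?vnorm2B_le ?vnorm2_ge0//.
by rewrite addr_ge0 ?mulr_ge0 ?vnorm2_ge0.
Qed.

Variable (Rb : R).
Hypothesis Rb0 : 0 < Rb.
Let D : set (measurableTypeR R) := `]0, Rb[%classic.
Let mD : measurable D. Proof. exact: measurable_itv. Qed.
Let muD : mu D = Rb%:E.
Proof. by rewrite /D lebesgue_measure_itv /= lte_fin Rb0 sube0. Qed.

Let muD_fin : (mu D < +oo)%E.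
Proof. by rewrite muD ltry. Qed.

Lemma integrable_cst_itv (r : R) : mu.-integrable D (EFin \o cst r).
Proof.
apply: (measurable_bounded_integrable mD muD_fin) => //.
by exists `|r|; split=> [|M rM x _]; [exact: num_real|exact: ltW].
Qed.

Lemma Rintegral_cst_itv (r : R) : \int[mu]_(p in D) r = r * Rb.
Proof. by rewrite (Rintegral_cst mu mD); congr (_ * _); exact: (congr1 fine muD). Qed.

(** From [|x| <= 1 + x^2], since [D] has finite measure. *)
Lemma L2vec_integrable f j b : L2vec f -> mu.-integrable D (EFin \o (fun p => part b (f p j 0))).
Proof.
move=> Lf; have iv : mu.-integrable D (EFin \o (fun p => vnorm2 (f p))).
  exact: integrableS (integrable_vnorm2 Lf).
have i1 : mu.-integrable D (EFin \o (fun p => 1 + 1 * vnorm2 (f p))).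
  exact: (integrable_lin mD 1 (integrable_cst_itv 1) iv).
apply: le_integrable i1 => //.
  apply/measurable_EFinP; apply: measurable_funS (L2vec_measurable Lf j b) => //.
move=> p _ /=; rewrite lee_fin mul1r [leRHS]ger0_norm ?addr_ge0 ?vnorm2_ge0//.
have := part_le_vnorm2 b (f p) j; set x := part _ _ => xv.
have := sqr_ge0 (x - 1); have := sqr_ge0 (x + 1); rewrite ler_norml => *.
by apply/andP; split; nra.
Qed.

(* AM-GM in place of the Cauchy-Schwarz inequality: [|x| <= eta + x^2 / eta]. *)
Lemma Rintegral_norm_le_L2dist2 f g j b eta : L2vec f -> L2vec g -> 0 < eta ->
  \int[mu]_(p in D) `|part b (f p j 0) - part b (g p j 0)| <=
  eta * Rb + eta^-1 * L2dist2 f g.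
Proof.
move=> Lf Lg eta0.
have iv : mu.-integrable setT (EFin \o (fun p => vnorm2 (f p - g p))) := integrable_vnorm2B Lf Lg.
have ivD : mu.-integrable D (EFin \o (fun p => vnorm2 (f p - g p))).
  exact: integrableS iv.
have vD : \int[mu]_(p in D) vnorm2 (f p - g p) <= L2dist2 f g.
  rewrite /L2dist2 Rintegral_mkcond; apply: le_Rintegral => //.
    by rewrite -restrict_EFin; apply/integrable_restrict => //; rewrite setTI.
  by move=> p _; rewrite patchE; case: ifPn => // _; exact: vnorm2_ge0.
have i1 := integrable_lin mD eta^-1 (integrable_cst_itv eta) ivD.
rewrite (@le_trans _ _ (\int[mu]_(p in D) (eta + eta^-1 * vnorm2 (f p - g p))))//.
  apply: le_Rintegral => //.
    apply: (@integrable_norm _ _ _ mu D (fun p => part b (f p j 0) - part b (g p j 0))).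
    by apply: integrable_subr => //; exact: L2vec_integrable.
  move=> p _.
  have := part_le_vnorm2 b (f p - g p) j; rewrite !mxE partB.
  set x := (X in X ^+ 2 <= _); set v := vnorm2 _ => xv.
  have [xe|ex] := leP `|x| eta.
    by rewrite (le_trans xe)// lerDl mulr_ge0 ?vnorm2_ge0// invr_ge0 ltW.
  apply: (@le_trans _ _ (eta^-1 * v)); last by rewrite lerDr ltW.
  rewrite ler_pdivlMl//; apply: le_trans xv; rewrite -real_normK ?num_real// expr2 ler_wpM2r//.
  exact: ltW.
have iz : mu.-integrable D (EFin \o (fun p => eta^-1 * vnorm2 (f p - g p))).
  by have := integrableZl mD eta^-1 ivD; apply: eq_integrable => // p _ /=; rewrite EFinM.
rewrite (RintegralD mD (integrable_cst_itv eta) iz).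
apply: lerD; first by rewrite le_eqVlt; apply/orP; left; apply/eqP; exact: Rintegral_cst_itv.
by rewrite RintegralZl// ler_wpM2l// invr_ge0 ltW.
Qed.

End SquareIntegrable.

(** * The defect of the reconstruction *)

Section Difference.
Set Implicit Arguments.
Unset Strict Implicit.
Variables (R : realType) (N : nat) (H1 H2 : 'M[R[i]]_N) (T : R).
Variables (uI : 'cV[R[i]]_N) (uf : R -> 'cV[R[i]]_N) (Rb : R) (psi : R -> R[i]).
Variables (w : R -> R -> 'cV[R[i]]_N) (P : 'M[R[i]]_N) (lam : 'I_N -> R).
Notation mu := (@lebesgue_measure R).
Hypotheses (T0 : 0 < T) (Rb0 : 0 < Rb).
Hypothesis odeu : ode_solution (H1 + 'i%C *: H2) uI uf.
Hypothesis psiE : {ae mu, forall p : R, 0 < p < Rb -> psi p = ((expR (- p))%:C)%C}.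
Hypothesis gsw : group_solution H1 H2 T (fun p => psi p *: uI) w.
Hypothesis Pu : P \in unitmx.
Hypothesis PH : P *m H1 = diag_mx (\row_k ((lam k)%:C)%C) *m P.

Let D : set (measurableTypeR R) := `]0, Rb[%classic.
Let mD : measurable D. Proof. exact: measurable_itv. Qed.
Let J : finType := ('I_N * bool)%type.
(** The term [i H2] in the eigenbasis of [H1]; its realification [B] is the coupling between
    characteristics. *)
Let Q := P *m ('i%C *: H2) *m invmx P.
Let B (k l : J) : R := mulpart (Q k.1 l.1) k.2 l.2.

Definition defect s p : 'cV[R[i]]_N := w s p - ((expR (- p))%:C)%C *: uf s.
Definition defect_coord (k : J) s p : R := part k.2 ((P *m defect s p) k.1 0).

(** The coordinate [y] is expanded in two ways: over the standard coordinates [x], for integrability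
    and continuity in time, and as [V] minus the exponential times [U], for the weak equation. *)
Let x (j : J) s p : R := part j.2 (w s p j.1 0) - expR (- p) * part j.2 (uf s j.1 0).
Let y := defect_coord.
Let V (k : J) s p : R := part k.2 ((P *m w s p) k.1 0).
Let U (k : J) s : R := part k.2 ((P *m uf s) k.1 0).

Let yx (k : J) s p : y k s p = \sum_(j : J) mulpart (P k.1 j.1) k.2 j.2 * x j s p.
Proof.
rewrite /y /defect_coord part_mulmx; apply: eq_bigr => j _.
by rewrite /defect !mxE partB partZ.
Qed.

Let yVU (k : J) s p : y k s p = V k s p - expR (- p) * U k s.
Proof.
rewrite /y /defect_coord /V /U mulmxBr -scalemxAr.
by move: (P *m w s p) (P *m uf s) => v u; rewrite !mxE partB partZ.
Qed.

Let L2w s : 0 <= s <= T -> L2vec (w s).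
Proof. by case: gsw => + _; apply. Qed.

Let intx (j : J) s : 0 <= s <= T -> mu.-integrable D (EFin \o x j s).
Proof.
move=> sT; have := integrable_lin mD (- part j.2 (uf s j.1 0))
  (L2vec_integrable Rb0 j.1 j.2 (L2w sT)) (@integrable_expN R Rb).
by apply: eq_integrable => // p _ /=; rewrite /x mulNr [_ * expR _]mulrC.
Qed.

Let inty (k : J) s : 0 <= s <= T -> mu.-integrable D (EFin \o y k s).
Proof.
move=> sT; have := integrable_fsum mD (fun j : J => mulpart (P k.1 j.1) k.2 j.2)
  (fun j => intx j sT).
by apply: eq_integrable => // p _ /=; rewrite yx.
Qed.

Let intV (k : J) s : 0 <= s <= T -> mu.-integrable D (EFin \o V k s).
Proof.
move=> sT; have := integrable_fsum mD (fun j : J => mulpart (P k.1 j.1) k.2 j.2)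
  (fun j : J => L2vec_integrable Rb0 j.1 j.2 (L2w sT)).
by apply: eq_integrable => // p _ /=; rewrite /V part_mulmx.
Qed.

Let is_derive_uf (j : J) s : is_derive s (1 : R) (fun s => part j.2 (uf s j.1 0))
  (part j.2 (((H1 + 'i%C *: H2) *m uf s) j.1 0)).
Proof. by case: odeu => _ /(_ s j.1) []; case: j => j [|]. Qed.

Let is_derive_U (k : J) s : is_derive s (1 : R) (U k)
  (part k.2 ((P *m ((H1 + 'i%C *: H2) *m uf s)) k.1 0)).
Proof.
have -> : U k = \sum_(j : J) (fun s => mulpart (P k.1 j.1) k.2 j.2 * part j.2 (uf s j.1 0)).
  by apply/funext => s'; rewrite fct_sumE /U part_mulmx.
rewrite part_mulmx.
apply: (big_ind2 (fun (f : R -> R) (l : R) => is_derive s (1 : R) f l)).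
- exact: is_derive_cst.
- by move=> f1 l1 f2 l2 D1 D2; exact: is_deriveD.
- by move=> j _; exact: (is_deriveZ _ (is_derive_uf j s)).
Qed.

Let continuous_uf (j : J) : continuous (fun s => part j.2 (uf s j.1 0)).
Proof.
move=> s; have [Ds _] := is_derive_uf j s.
by apply: differentiable_continuous; exact/derivable1_diffP.
Qed.

Let near_x (j : J) s0 e : 0 <= s0 <= T -> 0 < e ->
  \forall s \near s0, 0 <= s <= T -> \int[mu]_(p in D) `|x j s p - x j s0 p| < e.
Proof.
move=> s0T e0.
(* Three terms of size [e / 3]: [eta * Rb] and [eta^-1 * L2dist2] from the bound on [w], and at most
   [eta * Rb] from [uf], since [expR (- p) <= 1] on [D]. *)
pose eta := e / 3 / Rb.
have eta0 : 0 < eta by rewrite !divr_gt0.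
have [d d0 Hd] : exists2 d : R, 0 < d & forall t, 0 <= t <= T -> `|t - s0| < d ->
       L2dist2 (w t) (w s0) < e / 3 * eta.
  by case: gsw => _ [+ _]; apply => //; rewrite mulr_gt0// divr_gt0.
have ue : \forall s \near s0, `|part j.2 (uf s j.1 0) - part j.2 (uf s0 j.1 0)| < eta.
  have /cvgrPdist_lt /(_ _ eta0) := @continuous_uf j s0.
  by apply: filterS => s; rewrite distrC.
near=> s => sT.
have sd : `|s - s0| < d.
  by near: s; exists d => // s /=; rewrite distrC.
have su : `|part j.2 (uf s j.1 0) - part j.2 (uf s0 j.1 0)| < eta by near: s.
set r := `|_ - _| in su.
have iw := L2vec_integrable Rb0 j.1 j.2 (L2w sT).
have iw0 := L2vec_integrable Rb0 j.1 j.2 (L2w s0T).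
have iww := @integrable_norm _ _ _ mu D _ (integrable_subr mD iw iw0).
have ir : mu.-integrable D (EFin \o cst r) by exact: integrable_cst_itv.
apply: (@le_lt_trans _ _ (\int[mu]_(p in D)
   (`|part j.2 (w s p j.1 0) - part j.2 (w s0 p j.1 0)| + cst r p))).
  apply: le_Rintegral => //.
  - apply: (@integrable_norm _ _ _ mu D (fun p => x j s p - x j s0 p)).
    exact (integrable_subr mD (intx j sT) (intx j s0T)).
  - by have := integrableD mD iww ir; apply: eq_integrable.
  move=> p; rewrite /D /= in_itv /= => /andP[p0 _].
  have -> : x j s p - x j s0 p = (part j.2 (w s p j.1 0) - part j.2 (w s0 p j.1 0)) -
     expR (- p) * (part j.2 (uf s j.1 0) - part j.2 (uf s0 j.1 0)) by rewrite /x; ring.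
  rewrite (le_trans (ler_normB _ _))// lerD2l normrM ler_piMl//.
  by rewrite ger0_norm ?expR_ge0// -expR0 ler_expR lerNl oppr0 ltW.
rewrite (RintegralD mD iww ir).
have -> : e = (e / 3 + e / 3) + e / 3 by field.
apply: ltrD.
  apply: (le_lt_trans (Rintegral_norm_le_L2dist2 Rb0 j.1 j.2 (L2w sT) (L2w s0T) eta0)).
  apply: ler_ltD; first by rewrite /eta divfK// gt_eqF.
  by rewrite mulrC ltr_pdivrMr//; exact: Hd.
rewrite (Rintegral_cst_itv Rb0).
by rewrite -ltr_pdivlMr.
Unshelve. all: by end_near. Qed.


Let conty (k : J) s0 : 0 <= s0 <= T -> forall e, 0 < e -> exists2 d, 0 < d &
  forall s, 0 <= s <= T -> `|s - s0| < d -> \int[mu]_(p in D) `|y k s p - y k s0 p| < e.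
Proof.
move=> s0T e e0.
pose c (j : J) := mulpart (P k.1 j.1) k.2 j.2.
pose M := 1 + \sum_j `|c j|.
have M0 : 0 < M by rewrite ltr_wpDr// sumr_ge0.
(* Finitely many neighbourhoods intersect in one, which yields a radius common to all
   coordinates. *)
have /filter_forall[d /= d0 Hd] := fun j => near_x j s0T (divr_gt0 e0 M0).
exists d => // s sT sd.
have iB j : mu.-integrable D (EFin \o (fun p => x j s p - x j s0 p)).
  exact (integrable_subr mD (intx j sT) (intx j s0T)).
have iN j : mu.-integrable D (EFin \o (fun p => `|x j s p - x j s0 p|)).
  exact (@integrable_norm _ _ _ mu D _ (iB j)).
have Hj j : \int[mu]_(p in D) `|x j s p - x j s0 p| < e / M.
  by apply: Hd => //=; rewrite distrC.
apply: (@le_lt_trans _ _ (\int[mu]_(p in D) (\sum_j `|c j| * `|x j s p - x j s0 p|))).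
  apply: le_Rintegral => //.
  - apply: (@integrable_norm _ _ _ mu D (fun p => y k s p - y k s0 p)).
    exact (integrable_subr mD (inty k sT) (inty k s0T)).
  - exact (integrable_fsum mD (fun j => `|c j|) iN).
  move=> p _; rewrite !yx -sumrB (le_trans (ler_norm_sum _ _ _))//.
  by apply: ler_sum => j _; rewrite -mulrBr normrM.
rewrite (Rintegral_fsum mD (fun j => `|c j|) iN).
apply: (@le_lt_trans _ _ (\sum_j `|c j| * (e / M))).
  by apply: ler_sum => j _; rewrite ler_wpM2l// ltW.
by rewrite -mulr_suml mulrCA gtr_pMr// ltr_pdivrMr// mul1r /M ltrDr.
Qed.

Let y0 (k : J) : {ae mu, forall p, D p -> y k 0 p = 0}.
Proof.
have [_ [_ [w0 _]]] := gsw; have [u0 _] := odeu.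
have aeF := ae_filter_ringOfSetsType mu.
move: psiE w0; apply: filterS2 => p psip wp Dp.
have p0R : 0 < p < Rb by move: Dp; rewrite /D /= in_itv.
rewrite /y /defect_coord /defect wp u0 psip// subrr mulmx0 mxE.
exact: part0.
Qed.

Let PA (k : J) (v : 'cV[R[i]]_N) : part k.2 ((P *m ((H1 + 'i%C *: H2) *m v)) k.1 0) =
  lam k.1 * part k.2 ((P *m v) k.1 0) + \sum_l B k l * part l.2 ((P *m v) l.1 0).
Proof.
have -> : P *m ((H1 + 'i%C *: H2) *m v) =
    diag_mx (\row_k ((lam k)%:C)%C) *m (P *m v) + Q *m (P *m v).
  rewrite mulmxDl mulmxDr !mulmxA PH; congr (_ + _).
  by rewrite /Q mulmxKV.
rewrite mxE partD mul_diag_mx; congr (_ + _); last exact: part_mulmx.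
by rewrite mxE mxE partZ.
Qed.

(** * The weak equation for the defect *)

Section Weak.
Variables (k : J) (a : R -> R) (s : R).
Hypothesis Ca : C1c a.
Hypothesis a0 : forall p, ~~ (0 < p < Rb) -> a p = 0.
Hypothesis sT : 0 < s < T.

Let sT' : 0 <= s <= T. Proof. by case/andP: sT => *; rewrite !ltW. Qed.

Let a'0 := derive1_support Ca a0.

Let c0 := \int[mu]_(p in D) (a p * expR (- p)).

(** The vector test function [chi] is [a] times the transposed row [k.1] of [P]. As [pairing] is
    bilinear, without conjugation, it extracts the coordinate [k.1] of [P *m w]. *)
Let ar (j : 'I_N) (p : R) : R := complex.Re (P k.1 j) * a p.
Let ai (j : 'I_N) (p : R) : R := complex.Im (P k.1 j) * a p.
Let chi p : 'cV[R[i]]_N := \col_j ((ar j p) +i* (ai j p))%C.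
Let dchi p : 'cV[R[i]]_N := \col_j ((derive1 (ar j) p) +i* (derive1 (ai j) p))%C.
Let Achi p : 'cV[R[i]]_N := H1^T *m dchi p + 'i%C *: (H2^T *m chi p).

Let chiE p : chi p = ((a p)%:C)%C *: (row k.1 P)^T.
Proof.
apply/colP => j; rewrite !mxE /ar /ai; case: (P k.1 j) => b c /=.
by apply/eqP; rewrite eq_complex /= !mul0r subr0 addr0 ![_ * a p]mulrC !eqxx.
Qed.

Let dchiE p : dchi p = ((derive1 a p)%:C)%C *: (row k.1 P)^T.
Proof.
apply/colP => j; rewrite !mxE /ar /ai !derive1_scale//; case: (P k.1 j) => b c /=.
by apply/eqP; rewrite eq_complex /= !mul0r subr0 addr0 ![_ * derive1 a p]mulrC !eqxx.
Qed.

Let sum_tr (v u : 'cV[R[i]]_N) : \sum_j v j 0 * u j 0 = (u^T *m v) 0 0.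
Proof. by rewrite mxE; apply: eq_bigr => j _; rewrite mxE mulrC. Qed.

Let rowM (A : 'M[R[i]]_N) (v : 'cV[R[i]]_N) : (row k.1 A *m v) 0 0 = (A *m v) k.1 0.
Proof. by rewrite -row_mul mxE. Qed.

Let sum_chi (v : 'cV[R[i]]_N) p : part k.2 (\sum_j v j 0 * chi p j 0) = a p * part k.2 ((P *m v) k.1 0).
Proof.
rewrite sum_tr chiE linearZ /= trmxK -scalemxAl mxE partZ.
by congr (_ * part _ _); exact: rowM.
Qed.

(** Transposition moves [H1] and [i H2] onto the row [k.1] of [P], where the former acts as the
    scalar [lam k.1] and the latter becomes a row of [Q *m P]. *)
Let sum_Achi (v : 'cV[R[i]]_N) p : part k.2 (\sum_j v j 0 * Achi p j 0) =
  lam k.1 * (derive1 a p * part k.2 ((P *m v) k.1 0)) +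
  \sum_l B k l * (a p * part l.2 ((P *m v) l.1 0)).
Proof.
have -> : \sum_j v j 0 * Achi p j 0 =
    ((derive1 a p)%:C)%C * (P *m H1 *m v) k.1 0 +
    ((a p)%:C)%C * (P *m ('i%C *: H2) *m v) k.1 0.
  have E1 c : (H1^T *m (c *: (row k.1 P)^T))^T = c *: (row k.1 P *m H1).
    by rewrite trmx_mul trmxK linearZ /= trmxK -scalemxAl.
  have E2 c : ('i%C *: (H2^T *m (c *: (row k.1 P)^T)))^T = c *: (row k.1 P *m ('i%C *: H2)).
    rewrite linearZ /= trmx_mul trmxK linearZ /= trmxK -scalemxAl -scalemxAr.
    by rewrite !scalerA [_ * c]mulrC.
  rewrite sum_tr /Achi chiE dchiE linearD /= E1 E2 mulmxDl -!scalemxAl -!row_mul mxE.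
  by congr (_ + _); rewrite mxE [X in _ * X]mxE.
rewrite partD !partZ PH -!mulmxA mul_diag_mx; congr (_ + _).
  by rewrite mxE mxE partZ mulrCA.
have -> : P *m ('i%C *: H2 *m v) = Q *m (P *m v) by rewrite mulmxA /Q mulmxA mulmxKV.
by rewrite part_mulmx mulr_sumr; apply: eq_bigr => l _; rewrite mulrCA.
Qed.

Let is_derive_pairing : is_derive s (1 : R)
  (fun s => part k.2 (pairing (w s) chi)) (part k.2 (pairing (w s) Achi)).
Proof.
have [_ [_ [_ /(_ ar ai)]]] := gsw.
move=> /(_ (fun j => C1c_scale _ Ca) (fun j => C1c_scale _ Ca) s sT) [].
by case: (k) => ? [].
Qed.

Let part_cintegral b (h : R -> R[i]) :
  part b (cintegral h) = \int[mu]_p part b (h p).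
Proof. by case: b. Qed.

Let pairing_chi t : part k.2 (pairing (w t) chi) = \int[mu]_(p in D) (a p * V k t p).
Proof.
rewrite /pairing part_cintegral; under eq_Rintegral do rewrite sum_chi.
by apply: Rintegral_support => p /a0 ->; rewrite mul0r.
Qed.

Let bounded_mul (b f : R -> R) : continuous b -> (exists2 L, 0 <= L & forall p, `|b p| <= L) ->
  mu.-integrable D (EFin \o f) -> mu.-integrable D (EFin \o (fun p => b p * f p)).
Proof. by move=> cb [L _ bL] intf; exact (integrable_bounded_mul mD cb bL intf). Qed.

Let inta (f : R -> R) : mu.-integrable D (EFin \o f) ->
  mu.-integrable D (EFin \o (fun p => a p * f p)).
Proof. by apply: bounded_mul; [exact: C1c_continuous|exact: C1c_bounded]. Qed.

Let inta' (f : R -> R) : mu.-integrable D (EFin \o f) ->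
  mu.-integrable D (EFin \o (fun p => derive1 a p * f p)).
Proof. by apply: bounded_mul; [case: Ca => _ []|exact: C1c_derive1_bounded]. Qed.

Let pairing_Achi : part k.2 (pairing (w s) Achi) =
  lam k.1 * \int[mu]_(p in D) (derive1 a p * V k s p) +
  \sum_l B k l * \int[mu]_(p in D) (a p * V l s p).
Proof.
rewrite /pairing part_cintegral; under eq_Rintegral do rewrite sum_Achi.
rewrite (@Rintegral_support R Rb) => [|p Hp]; last first.
  by rewrite a'0// a0// mul0r mulr0 add0r big1// => l _; rewrite mul0r mulr0.
have i1 := inta' (intV k sT').
have i2 l := inta (intV l sT').
have i3 := integrable_fsum mD (B k) i2.
have i4 : mu.-integrable D (EFin \o (fun p => lam k.1 * (derive1 a p * V k s p))).
  by have := integrableZl mD (lam k.1) i1; apply: eq_integrable => // p _ /=; rewrite EFinM.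
by rewrite (RintegralD mD i4 i3) (RintegralZl _ mD i1) (Rintegral_fsum mD (B k) i2).
Qed.

Let Rintegral_y l t (b : R -> R) : 0 <= t <= T ->
  (forall f : R -> R, mu.-integrable D (EFin \o f) -> mu.-integrable D (EFin \o (fun p => b p * f p))) ->
  \int[mu]_(p in D) (b p * y l t p) =
  \int[mu]_(p in D) (b p * V l t p) - U l t * \int[mu]_(p in D) (b p * expR (- p)).
Proof.
move=> tT intb.
have i1 := intb _ (intV l tT); have i2 := intb _ (@integrable_expN R Rb).
have i3 : mu.-integrable D (EFin \o (fun p => U l t * (b p * expR (- p)))).
  by have := integrableZl mD (U l t) i2; apply: eq_integrable => // p _ /=; rewrite EFinM.
rewrite -(RintegralZl _ mD i2) -(RintegralB mD i1 i3); apply: eq_Rintegral => p _.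
by rewrite yVU; ring.
Qed.

(** The exponential part contributes [c0 * U k s]. Its derivative by the ODE contains
    [lam k.1 * c0 * U k s], whereas the transport term calls for the integral of
    [derive1 a p * expR (- p)] in place of [c0]; the two integrals agree by
    [Rintegral_derive1_expN]. *)
Lemma defect_weak_equation : is_derive s (1 : R) (fun s => \int[mu]_(p in D) (a p * y k s p))
   (lam k.1 * \int[mu]_(p in D) (derive1 a p * y k s p) +
    \sum_l B k l * \int[mu]_(p in D) (a p * y l s p)).
Proof.
have D1 := is_deriveB is_derive_pairing (is_deriveZ c0 (is_derive_U k s)).
have E : part k.2 (pairing (w s) Achi) -
    c0 *: part k.2 ((P *m ((H1 + 'i%C *: H2) *m uf s)) k.1 0) =
   lam k.1 * \int[mu]_(p in D) (derive1 a p * y k s p) +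
    \sum_l B k l * \int[mu]_(p in D) (a p * y l s p).
  rewrite pairing_Achi PA (Rintegral_y k sT' inta').
  rewrite (Rintegral_derive1_expN Rb0 Ca a0) -/c0.
  have -> : \sum_l B k l * \int[mu]_(p in D) (a p * y l s p) =
      \sum_l B k l * \int[mu]_(p in D) (a p * V l s p) - c0 * \sum_l B k l * U l s.
    rewrite mulr_sumr -sumrB; apply: eq_bigr => l _.
    by rewrite (Rintegral_y l sT' inta) -/c0; ring.
  rewrite /GRing.scale /= -/(U k s) -[X in lam k.1 * U k s + X]/(\sum_l B k l * U l s).
  ring.
(* Splitting the pairing requires [w t] in L^2, hence [t] in [[0, T]], so the two functions of time
   are compared only near [s]. *)
rewrite -E; apply: near_eq_is_derive D1.
near=> t.
have tT : 0 <= t <= T.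
  apply/andP; split; apply: ltW; near: t.
    by apply: lt_nbhsr; case/andP: sT.
  by apply: lt_nbhsl; case/andP: sT.
by rewrite (Rintegral_y k tT inta) -pairing_chi mulrC.
Unshelve. all: by end_near. Qed.

End Weak.

Lemma defect_eq0 : {ae mu, forall p,
  lam_pos_max H1 * T < p < Rb - lam_neg_max H1 * T -> defect T p = 0}.
Proof.
have := @propagation R J y (fun k => lam k.1) B T Rb (lam_pos_max H1) (lam_neg_max H1) T0
  (lam_pos_max_ge0 Pu PH) (lam_neg_max_ge0 Pu PH) (fun k => diag_lam_bound Pu PH k.1)
  inty conty (fun k a Ca a0 s sT => @defect_weak_equation k a s Ca a0 sT) y0.
apply: filterS; first exact: (ae_filter_ringOfSetsType mu).
move=> p Hp pT; have Pd : P *m defect T p = 0.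
  by apply/colP => k; rewrite [RHS]mxE; apply: part_eq0 => b; exact: (Hp pT (k, b)).
by rewrite -[defect T p](mulKmx Pu) Pd mulmx0.
Qed.

End Difference.

Theorem theorem5p1 (R : realType) (N : nat) (H1 H2 : 'M[R[i]]_N) (T : R)
    (uI : 'cV[R[i]]_N) (uf : R -> 'cV[R[i]]_N) (Rb : R) (psi : R -> R[i])
    (w : R -> R -> 'cV[R[i]]_N) :
  is_hermitian H1 -> is_hermitian H2 -> 0 < T ->
  ode_solution (H1 + 'i%C *: H2) uI uf ->
  (lam_neg_max H1 + lam_pos_max H1) * T < Rb ->
  L2fun psi ->
  {ae lebesgue_measure, forall p : R, 0 < p < Rb -> psi p = ((expR (- p))%:C)%C} ->
  group_solution H1 H2 T (fun p => psi p *: uI) w ->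
  {ae lebesgue_measure, forall p : R,
     lam_pos_max H1 * T < p < Rb - lam_neg_max H1 * T ->
     uf T = ((expR p)%:C)%C *: w T p}.
Proof.
move=> H1herm _ T0 odeu TRb _ psiE gsw.
have [P Pu [lam PH]] := hermitian_diagonalization H1herm.
have Rb0 : 0 < Rb.
  rewrite (le_lt_trans _ TRb)// mulr_ge0 ?addr_ge0//; last exact: ltW.
    exact: (lam_neg_max_ge0 Pu PH).
  exact: (lam_pos_max_ge0 Pu PH).
have := defect_eq0 T0 Rb0 odeu psiE gsw Pu PH.
apply: filterS; first exact: (ae_filter_ringOfSetsType lebesgue_measure).
move=> p Hp pT; have /eqP := Hp pT; rewrite /defect subr_eq0 => /eqP ->.
by rewrite scalerA -rmorphM -expRD subrr expR0 rmorph1 scale1r.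
Qed.
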